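(* Let $X$ be a separable infinite-dimensional (real) Hilbert space and let $U$ be an open subset of $X$. Then, for all continuous functions $f:U\longrightarrow\mathbb{R}$ and $\varepsilon:U\longrightarrow(0,+\infty)$, there exists a $C^\infty$ smooth function $\psi:U\longrightarrow\mathbb{R}$ such that $|f(x)-\psi(x)|\leq\varepsilon(x)$ and $\psi'(x)\neq 0$ for every $x\in U$.
   Context: $C^\infty$ smoothness is in the Fréchet sense, and $\psi'(x)\in X^*$ denotes the Fréchet derivative of $\psi$ at $x$. *)

(* Defs.v *)
From HB Require Import structures.
From mathcomp Require Import all_boot all_order all_algebra sesquilinear.
From mathcomp Require Import all_classical all_reals all_analysis.

Set Implicit Arguments.
Unset Strict Implicit.
Unset Printing Implicit Defensive.

Import Order.TTheory GRing.Theory Num.Theory.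
Import numFieldTopology.Exports numFieldNormedType.Exports.

Local Open Scope classical_set_scope.
Local Open Scope ring_scope.

Definition separable (T : topologicalType) : Prop :=
  exists2 A : set T, countable A & dense A.

Definition finite_dimensional (K : nzRingType) (V : lmodType K) : Prop :=
  exists s : seq V, forall v : V,
    exists c : 'I_(size s) -> K, v = \sum_(i < size s) c i *: s`_i.

(* A real Hilbert space is a complete normed space whose norm comes from an
   inner product, i.e. a symmetric positive definite bilinear form. *)
Definition norm_of_inner_product (R : realType) (V : normedModType R)
    (dot : {dot V for @idfun R}) : Prop :=
  forall v : V, `|v| = Num.sqrt (dot v v).

Section ContinuousLinear.
Context {R : realType} (V W : normedModType R).

Definition clin : {pred V -> W} := mem [set f | linear f /\ continuous f].

Record clinear := CLinear {
  clinear_fun :> V -> W;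
  clinear_clin : clinear_fun \in clin
}.

HB.instance Definition _ := [isSub for clinear_fun].
HB.instance Definition _ := [Choice of clinear by <:].

Lemma clin_submod_closed : submod_closed clin.
Proof.
split=> [|a f g].
  apply/mem_set; split=> [a x y|x]; first by rewrite scaler0 addr0.
  exact: cvg_cst.
move=> /set_mem[lf cf] /set_mem[lg cg]; apply/mem_set; split=> [b x y|x].
  by rewrite !fctE lf lg !scalerDr !scalerA mulrC addrACA.
by apply: cvgD; [apply: cvgZl_tmp; exact: cf|exact: cg].
Qed.

HB.instance Definition _ := GRing.isSubmodClosed.Build R (V -> W) clin
  clin_submod_closed.
HB.instance Definition _ := [SubChoice_isSubLmodule of clinear by <:].

Lemma clinear_linear (f : clinear) : linear f.
Proof. by case: (set_mem (clinear_clin f)). Qed.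

Lemma clinear_continuous (f : clinear) : continuous f.
Proof. by case: (set_mem (clinear_clin f)). Qed.

HB.instance Definition _ (f : clinear) :=
  GRing.isLinear.Build R V W _ f (clinear_linear f).

Definition opnorm (f : clinear) : R :=
  sup [set `|f x| | x in [set x : V | `|x| <= 1]].

Lemma opnorm_has_sup (f : clinear) :
  has_sup [set `|f x| | x in [set x : V | `|x| <= 1]].
Proof.
split; first by exists `|f 0|, 0 => //=; rewrite normr0.
have /linear_bounded_continuous/bounded_funP/(_ 1)[M fM] :=
  @clinear_continuous f.
by exists M => _ [x x1 <-]; exact: fM.
Qed.

Lemma opnorm_ub (f : clinear) (x : V) : `|x| <= 1 -> `|f x| <= opnorm f.
Proof.
by move=> x1; apply: sup_upper_bound; [exact: opnorm_has_sup|exists x].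
Qed.

Lemma opnorm_le (f : clinear) (M : R) :
  (forall x : V, `|x| <= 1 -> `|f x| <= M) -> opnorm f <= M.
Proof.
move=> fM; apply: ge_sup; first by case: (opnorm_has_sup f).
by move=> _ [x x1 <-]; exact: fM.
Qed.

Lemma opnorm_ge0 (f : clinear) : 0 <= opnorm f.
Proof. by rewrite (le_trans _ (@opnorm_ub f 0 _)) ?normr0. Qed.

Lemma le_opnorm (f : clinear) (x : V) : `|f x| <= opnorm f * `|x|.
Proof.
have [->|x0] := eqVneq x 0; first by rewrite linear0 !normr0 mulr0.
rewrite -ler_pdivrMr ?normr_gt0// -[X in _ / X]normr_id -normfV mulrC -normrZ.
rewrite -linearZ/= opnorm_ub// normrZ normfV normr_id mulVf//.
by rewrite normr_eq0.
Qed.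

Lemma ler_opnormD (f g : clinear) : opnorm (f + g) <= opnorm f + opnorm g.
Proof.
apply: opnorm_le => x x1; rewrite (le_trans (ler_normD _ _))//.
by rewrite lerD// opnorm_ub.
Qed.

Lemma opnormZ (a : R) (f : clinear) : opnorm (a *: f) = `|a| * opnorm f.
Proof.
have le (b : R) (g : clinear) : opnorm (b *: g) <= `|b| * opnorm g.
  apply: opnorm_le => x x1; rewrite (_ : (b *: g) x = b *: g x)//.
  by rewrite normrZ ler_wpM2l// opnorm_ub.
apply/eqP; rewrite eq_le le/=.
have [->|a0] := eqVneq a 0; first by rewrite normr0 mul0r opnorm_ge0.
rewrite -ler_pdivlMl ?normr_gt0// -normfV (le_trans _ (le _ _))//.
by rewrite scalerA mulVf// scale1r.
Qed.

Lemma opnorm0_eq0 (f : clinear) : opnorm f = 0 -> f = 0.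
Proof.
move=> f0; apply/val_inj/funext => x; apply/eqP.
by rewrite -normr_le0 (le_trans (le_opnorm f x))// f0 mul0r.
Qed.

HB.instance Definition _ := Lmodule_isNormed.Build R clinear
  ler_opnormD opnormZ opnorm0_eq0.

End ContinuousLinear.

(* Functions on an open set U are represented by total functions of which only
   the values on U matter. *)
Fixpoint Ck (R : realType) (V : normedModType R) (k : nat) :
    forall W : normedModType R, set V -> (V -> W) -> Prop :=
  match k with
  | 0 => fun W U f => {within U, continuous f}
  | k.+1 => fun W U f => exists2 Df : V -> clinear V W,
      forall x, U x -> differentiable f x /\ 'd f x = Df x :> (V -> W)
      & Ck k U Df
  end.

Definition Cinfty (R : realType) (V W : normedModType R) (U : set V)
    (f : V -> W) : Prop :=
  forall k, Ck k U f.

(* Main.v *)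
Require Import Defs.
From HB Require Import structures.
From mathcomp Require Import all_boot all_order all_algebra sesquilinear.
From mathcomp Require Import all_classical all_reals all_analysis.
From mathcomp Require Import ring lra.

Set Implicit Arguments.
Unset Strict Implicit.
Unset Printing Implicit Defensive.

Import Order.TTheory GRing.Theory Num.Theory.
Import numFieldTopology.Exports numFieldNormedType.Exports.

Local Open Scope classical_set_scope.
Local Open Scope ring_scope.

(** The idea is to start from a smooth approximation of [f] whose gradient is
understood well, and to destroy its critical points by adding a small function
whose gradient always points in a direction that the rest cannot compensate.

Let [d] be a dense sequence of X and [e] an orthonormal sequence such that
[e j] is orthogonal to [d i] whenever [i <= j]; such an [e] exists because X is
infinite-dimensional ([orthonormal_sequence]). A smooth function of
|x - d 0|^2, ..., |x - d N|^2 has at x a gradient of the form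
lam(x) x + (a vector of the span of d 0, ..., d N). Functions that are locally
of this kind are called locally radial. Smooth bumps on balls centred at the
[d i] are radial, and they suffice to build, by [radial_selection], locally
radial functions F and delta such that |f - F| <= eps / 2 and
0 < delta <= eps / 2.

The approximation is psi(x) = F(x) + delta(x) <x, p(u(x))>, where p is a smooth
path of unit vectors which, for s in [j, j + 1], rotates [e j] into [e j.+1]
([path]), and u is a locally radial function with large values. Fix x, and let
M bound the indices of the [d i] that occur in the gradients of F, delta and u
at x. If u(x) >= M + 1, then p = p(u(x)) and p' = p'(u(x)) are orthogonal to
d 0, ..., d M, and p' is orthogonal to p since p has constant norm. Writing
lam, al, be for the coefficients of x in the gradients of F, delta, u, a
critical point of psi satisfies, on evaluating the derivative at p and at p',

  C <x, p> + delta = 0  and  C <x, p'> = 0,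
  where C = lam + al <x, p> + be delta <x, p'>.

The first equation gives C <> 0, hence <x, p'> = 0 by the second one. So u
disappears from C, and (lam + al <x, p>) <x, p> = - delta. This is impossible if
<x, p> is small compared with lam, al and delta. Now <x, p> is as small as
desired when u(x) is large, since |<x, p>| <= |x - d k| once u(x) >= k + 1.
It matters that the size required of u(x) depends on F, delta and x only, and
not on the gradient of u, over which there is no control. What remains is that
u(x) also has to exceed the indices that occur in its own gradient: this is
what [radial_exhaustion] provides. [perturbation_noncritical] carries out the
argument.

The perturbation of F is small in the C^0 sense only, as it has to be: one that
is small in the C^2 sense cannot remove a nondegenerate critical point. *)

(** * Calculus of functions of class [Ck] *)

Section Germ.
Context {R : realType} {V W : normedModType R}.
Implicit Types (f g : V -> W).

(** The defining estimate of the derivative at [x] only involves values near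
[x]. *)
Lemma is_diff_germ f g (x : V) :
  (\near x, f x = g x) -> differentiable g x -> is_diff x f ('d g x).
Proof.
move=> fg dg.
have fg0 : \forall h \near (0 : V), f (h + x) = g (h + x).
  by move: fg; rewrite (near_shift 0) subr0.
have fgx : f x = g x by exact: (nbhs_singleton fg).
have key : f \o shift x = cst (f x) + 'd g x +o_ 0 id.
  apply/eqaddoP => _/posnumP[e].
  have /diff_locally/eqaddoP/(_ e%:num (gt0 e)) := dg.
  apply: filter_app; near=> h => /=.
  rewrite !fctE /= fgx.
  have -> // : f (h + x) = g (h + x).
  by near: h.
have dE : 'd f x = 'd g x :> (V -> W).
  by apply: diff_unique => //; exact: diff_continuous.
apply: DiffDef => //; apply/diff_locallyP; rewrite dE; split => //.
exact: diff_continuous.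
Unshelve. all: by end_near. Qed.

End Germ.

Section CkBasics.
Context {R : realType} {V : normedModType R}.
Implicit Types (U W : set V).

Lemma Ck0P (W : normedModType R) (U : set V) (f : V -> W) : open U ->
  Ck 0 U f <-> forall x, U x -> {for x, continuous f}.
Proof. 
move=> oU; rewrite /= continuous_open_subspace//; split => h x.
  by move=> Ux; apply: h; rewrite inE.
by rewrite inE; exact: h.
Qed.

(** Derivatives are unique, so those of local representatives glue: the
derivative of [f], wherever it exists, is the only candidate, and it agrees
near each point with the one of the local representative. *)
Lemma Ck_local (k : nat) (W : normedModType R) (U : set V) (f : V -> W) :
  open U ->
  (forall x, U x -> exists (Q : set V) (g : V -> W),
    [/\ open Q, Q x, (forall y, Q y -> f y = g y) & Ck k Q g]) ->
  Ck k U f.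
Proof.
elim: k W f => [|k IH] W f oU h.
  apply/Ck0P => // x /h [Q [g [oO Ox fg /Ck0P]]] => /(_ oO) /(_ x Ox) cg.
  rewrite /prop_for /continuous_at (fg x Ox).
  apply: cvg_trans cg; apply: near_eq_cvg.
  near=> y; apply/esym/fg; near: y; exact: open_nbhs_nbhs.
pose Df (y : V) : clinear V W :=
  if pselect (exists L : clinear V W, 'd f y = L :> (V -> W)) is left e
  then projT1 (cid e) else 0.
have key (x : V) : U x -> exists (Q : set V) (Dg : V -> clinear V W),
    [/\ open Q, Q x, (forall y, Q y ->
      differentiable f y /\ 'd f y = Df y :> (V -> W)),
    (forall y, Q y -> Df y = Dg y) & Ck k Q Dg].
  move=> /h [Q [g [oO Ox fg [Dg dg CDg]]]]; exists Q, Dg.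
  have dfE (y : V) : Q y -> differentiable f y /\ 'd f y = Dg y :> (V -> W).
    move=> Oy; have [dgy dgE] := dg y Oy.
    have [] : is_diff y f ('d g y).
      by apply: is_diff_germ => //; near=> z; apply: fg; near: z;
        exact: open_nbhs_nbhs.
    by rewrite dgE.
  have DE (y : V) : Q y -> 'd f y = Df y :> (V -> W).
    move=> /dfE[_ e]; rewrite /Df; case: pselect => [ex|[]];
      last by exists (Dg y).
    by case: cid.
  split => // y Oy; first by split; [have [] := dfE y Oy|exact: DE].
  apply/val_inj => /=; rewrite -[LHS]DE//.
  by have [] := dfE y Oy.
exists Df => [x Ux|].
  by have [Q [Dg [oO Ox d _ _]]] := key x Ux; exact: d.
apply: IH => // x /key[Q [Dg [oO Ox _ E C]]].
by exists Q, Dg.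
Unshelve. all: by end_near. Qed.

Lemma Ck_sub (k : nat) (W : normedModType R) (Q U : set V) (f : V -> W) :
  open Q -> open U -> Q `<=` U -> Ck k U f -> Ck k Q f.
Proof.
elim: k W f => [|k IH] W f oO oU OU.
  by move=> /Ck0P-/(_ oU) h; apply/Ck0P => // x Ox; apply: h => //; exact: OU.
by move=> [Df d C]; exists Df => [x /OU/d//|]; exact: IH.
Qed.

Lemma Ck_eq (k : nat) (W : normedModType R) (U : set V) (f g : V -> W) :
  open U -> (forall x, U x -> f x = g x) -> Ck k U g -> Ck k U f.
Proof. by move=> oU fg Cg; apply: Ck_local => // x Ux; exists U, g. Qed.

Lemma Ck_le1 (k : nat) (W : normedModType R) (U : set V) (f : V -> W) :
  open U -> Ck k.+1 U f -> Ck k U f.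
Proof.
move=> oU; elim: k W f => [|k IH] W f [Df d C].
  apply/Ck0P => // x /d[+ _]; exact: differentiable_continuous.
by exists Df => //; exact: IH.
Qed.

Lemma Ck_add (k : nat) (W : normedModType R) (U : set V) (f g : V -> W) :
  open U -> Ck k U f -> Ck k U g -> Ck k U (fun x => f x + g x).
Proof.
move=> oU; elim: k W f g => [|k IH] W f g.
  move=> /Ck0P-/(_ oU) cf /Ck0P-/(_ oU) cg; apply/Ck0P => // x Ux.
  by apply: cvgD; [exact: cf|exact: cg].
move=> [Df df Cf] [Dg dg Cg]; exists (fun x => Df x + Dg x); last exact: IH.
move=> x Ux; have [dfx dfE] := df x Ux; have [dgx dgE] := dg x Ux.
by split; [exact: differentiableD|rewrite [LHS]diffD// dfE dgE].
Qed.

Lemma Ck_cst (k : nat) (W : normedModType R) (U : set V) (c : W) :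
  open U -> Ck k U (fun=> c).
Proof.
move=> oU; elim: k W c => [|k IH] W c; first by apply/Ck0P => // x _;
  exact: cvg_cst.
exists (fun=> 0) => [x Ux|]; last exact: IH.
by split; [exact: differentiable_cst|rewrite [LHS]diff_cst].
Qed.

Lemma Ck_linear (k : nat) (W : normedModType R) (U : set V) (L : clinear V W) :
  open U -> Ck k U L.
Proof.
move=> oU; case: k => [|k].
  by apply/Ck0P => // x _; exact: clinear_continuous.
exists (fun=> L) => [x Ux|]; last exact: Ck_cst.
have cL : continuous (L : {linear V -> W}) by exact: clinear_continuous.
by split; [exact: linear_differentiable|exact: diff_lin].
Qed.

End CkBasics.

Section BoundedBilinear.
Context {R : realType}.

Lemma bounded_linear_clin {V W : normedModType R} (f : V -> W) :
  linear f -> (exists C, forall v, `|f v| <= C * `|v|) -> f \in @clin R V W.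
Proof.
move=> lf [C hC]; apply/mem_set; split => //.
pose fM := GRing.isLinear.Build _ _ _ _ _ lf.
pose fL : {linear V -> W} := HB.pack f fM.
apply: (@bounded_linear_continuous _ _ _ fL).
apply/linear_boundedP; exists C; split => /=; first exact: num_real.
move=> D CD x; rewrite (le_trans (hC x))// ler_wpM2r// ltW//.
Qed.

(** Products of all kinds that occur when differentiating repeatedly (scalar by
vector, scalar by operator, inner product) are instances of this notion. *)
Definition bounded_bilinear {W1 W2 W3 : normedModType R} (B : W1 -> W2 -> W3) :=
  [/\ forall w, linear (B^~ w), forall u, linear (B u)
    & exists C, forall u w, `|B u w| <= C * (`|u| * `|w|)].

Lemma bounded_bilinear_ge0 {W1 W2 W3 : normedModType R} (B : W1 -> W2 -> W3) :
  bounded_bilinear B ->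
  exists2 C, 0 <= C & forall u w, `|B u w| <= C * (`|u| * `|w|).
Proof.
case=> _ _ [C hC]; exists `|C| => // u w; rewrite (le_trans (hC u w))//.
by rewrite ler_wpM2r ?mulr_ge0// ler_norm.
Qed.

Section Continuity.
Context {W1 W2 W3 : normedModType R} (B : W1 -> W2 -> W3).
Hypothesis bB : bounded_bilinear B.

Lemma bounded_bilinear_linearl w : linear (B^~ w). Proof. by case: bB. Qed.
Lemma bounded_bilinear_linearr u : linear (B u). Proof. by case: bB. Qed.

Lemma bounded_bilinear_continuous : continuous (fun p : W1 * W2 => B p.1 p.2).
Proof.
have [C C0 hC] := bounded_bilinear_ge0 bB.
have [ll lr _] := bB.
move=> p; apply/subr_cvg0; apply: norm_cvg0.
have BE (q : W1 * W2) :
    B q.1 q.2 - B p.1 p.2 = B (q.1 - p.1) q.2 + B p.1 (q.2 - p.2).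
  pose l := GRing.isLinear.Build _ _ _ _ _ (ll q.2).
  pose L : {linear W1 -> W3} := HB.pack (B^~ q.2) l.
  pose r := GRing.isLinear.Build _ _ _ _ _ (lr p.1).
  pose L' : {linear W2 -> W3} := HB.pack (B p.1) r.
  rewrite -[B (_ - _) _]/(L (q.1 - p.1)) -[B p.1 (_ - _)]/(L' (q.2 - p.2)).
  by rewrite !linearB/= addrA subrK.
pose h (q : W1 * W2) := C * (`|q.1 - p.1| * `|q.2|) + C * (`|p.1| * `|q.2 -
  p.2|).
apply: (@squeeze_cvgr _ _ _ _ (cst 0) h).
- near=> q; rewrite normr_ge0/= BE (le_trans (ler_normD _ _))//.
  by rewrite lerD// hC.
- exact: cvg_cst.
- have h1 : (fun q : W1 * W2 => q.1) @ p --> p.1 by exact: cvg_fst.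
  have h2 : (fun q : W1 * W2 => q.2) @ p --> p.2 by exact: cvg_snd.
  have -> : 0 = C * (`|p.1 - p.1| * `|p.2|) + C * (`|p.1| * `|p.2 - p.2|) :> R.
    by rewrite !subrr !normr0 mul0r !mulr0 addr0.
  apply: cvgD; (apply: cvgM; first exact: cvg_cst); apply: cvgM.
  + by apply: cvg_norm; apply: cvgB => //; exact: cvg_cst.
  + exact: cvg_norm.
  + exact: cvg_cst.
  + by apply: cvg_norm; apply: cvgB => //; exact: cvg_cst.
Unshelve. all: by end_near. Qed.

Lemma is_diff_bounded_bilinear {V : normedModType R} (f df : V -> W1)
    (g dg : V -> W2) (x : V) :
  is_diff x f df -> is_diff x g dg ->
  is_diff x (fun y => B (f y) (g y)) (fun v => B (df v) (g x) + B (f x) (dg v)).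
Proof.
move=> hf hg.
pose M := bilinear_isBilinear.Build R W1 W2 W3 *:%R *:%R B
  (conj bounded_bilinear_linearl bounded_bilinear_linearr).
pose b : {bilinear W1 -> W2 -> W3} := HB.pack B M.
have cb : continuous (fun p : W1 * W2 => b p.1 p.2).
  exact: bounded_bilinear_continuous.
have dfg := is_diff_pair hf hg.
have db : is_diff (f x, g x) (fun p : W1 * W2 => b p.1 p.2)
    (fun q => b (f x) q.2 + b q.1 (g x)).
  by apply: DiffDef; [exact: differentiable_bilin|rewrite diff_bilin].
have [e1 e2] := is_diff_comp dfg db.
apply: DiffDef => //; rewrite [LHS]e2; apply/funext => v /=.
by rewrite addrC.
Qed.

End Continuity.

(** The derivative of [x |-> B (f x) (g x)] is the sum of the two operators
below applied to [(Df x, g x)] and [(f x, Dg x)]. They are again bounded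
bilinear maps, now with values in a space of operators, which makes the
induction of [Ck_bilinear] possible. *)
Section Lift.
Context {V W1 W2 W3 : normedModType R} (B : W1 -> W2 -> W3).
Hypothesis bB : bounded_bilinear B.

Lemma lift_bilinearl_clin (L : clinear V W1) (w : W2) :
  (fun v => B (L v) w) \in @clin R V W3.
Proof.
have [ll lr _] := bB; have [C C0 hC] := bounded_bilinear_ge0 bB.
apply: bounded_linear_clin => [a u v|].
  by rewrite linearP ll.
exists (C * opnorm L * `|w|) => v; rewrite (le_trans (hC _ _))//.
rewrite -!mulrA ler_wpM2l// [`|w| * _]mulrC mulrA ler_wpM2r//.
exact: le_opnorm.
Qed.

Definition lift_bilinearl (L : clinear V W1) (w : W2) : clinear V W3 :=
  CLinear (lift_bilinearl_clin L w).

Lemma lift_bilinearr_clin (u : W1) (L : clinear V W2) :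
  (fun v => B u (L v)) \in @clin R V W3.
Proof.
have [ll lr _] := bB; have [C C0 hC] := bounded_bilinear_ge0 bB.
apply: bounded_linear_clin => [a x v|].
  by rewrite linearP lr.
exists (C * `|u| * opnorm L) => v; rewrite (le_trans (hC _ _))//.
by rewrite -!mulrA !ler_wpM2l// le_opnorm.
Qed.

Definition lift_bilinearr (u : W1) (L : clinear V W2) : clinear V W3 :=
  CLinear (lift_bilinearr_clin u L).

Lemma lift_bilinearl_bounded : bounded_bilinear lift_bilinearl.
Proof.
have [ll lr _] := bB; have [C C0 hC] := bounded_bilinear_ge0 bB.
split=> [w a L M|L a w w'|].
- by apply/val_inj/funext => v /=; rewrite [LHS]ll.
- by apply/val_inj/funext => v /=; rewrite [LHS]lr.
exists C => L w; apply: opnorm_le => v v1.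
rewrite (le_trans (hC _ _))// ler_wpM2l// ler_wpM2r//.
exact: opnorm_ub.
Qed.

Lemma lift_bilinearr_bounded : bounded_bilinear lift_bilinearr.
Proof.
have [ll lr _] := bB; have [C C0 hC] := bounded_bilinear_ge0 bB.
split=> [w a L M|L a w w'|].
- by apply/val_inj/funext => v /=; rewrite [LHS]ll.
- by apply/val_inj/funext => v /=; rewrite [LHS]lr.
exists C => L w; apply: opnorm_le => v v1.
rewrite (le_trans (hC _ _))// ler_wpM2l// ler_wpM2l//.
exact: opnorm_ub.
Qed.

End Lift.

(** The induction on [k] has to let the target spaces and [B] vary, because the
Leibniz rule replaces [B] by its two lifts. *)
Lemma Ck_bilinear (k : nat) {V W1 W2 W3 : normedModType R} (U : set V)
    (B : W1 -> W2 -> W3) (f : V -> W1) (g : V -> W2) :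
  open U -> bounded_bilinear B -> Ck k U f -> Ck k U g ->
  Ck k U (fun x => B (f x) (g x)).
Proof.
move=> oU; elim: k W1 W2 W3 B f g => [|k IH] W1 W2 W3 B f g bB.
  move=> /Ck0P-/(_ oU) cf /Ck0P-/(_ oU) cg; apply/Ck0P => // x Ux.
  apply: (@continuous_comp _ _ _ (fun y => (f y, g y)) (fun p => B p.1 p.2)).
    by apply: cvg_pair; [exact: cf|exact: cg].
  exact: bounded_bilinear_continuous.
move=> Cf Cg; have [Df df Cf'] := Cf; have [Dg dg Cg'] := Cg.
exists (fun x => lift_bilinearl bB (Df x) (g x) + lift_bilinearr bB (f x)
  (Dg x)).
  move=> x Ux; have [dfx dfE] := df x Ux; have [dgx dgE] := dg x Ux.
  have hf : is_diff x f (Df x) by exact: DiffDef.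
  have hg : is_diff x g (Dg x) by exact: DiffDef.
  by have [] := is_diff_bounded_bilinear bB hf hg.
apply: Ck_add => //; apply: IH => //.
- exact: lift_bilinearl_bounded.
- exact: Ck_le1.
- exact: lift_bilinearr_bounded.
- exact: Ck_le1.
Qed.

Lemma scale_bounded_bilinear {W : normedModType R} :
  bounded_bilinear (fun (a : R) (w : W) => a *: w).
Proof.
split=> [w a b c|u a b c|]; first by rewrite scalerDl scalerA.
  by rewrite scalerDr !scalerA mulrC.
by exists 1 => u w; rewrite normrZ mul1r.
Qed.

Lemma Ck_scale (k : nat) {V W : normedModType R} (U : set V) (f : V -> R)
    (g : V -> W) : open U -> Ck k U f -> Ck k U g ->
      Ck k U (fun x => f x *: g x).
Proof. by move=> oU; apply: Ck_bilinear => //;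
  exact: scale_bounded_bilinear. Qed.

(** One step of the induction that shows that composing with a smooth real
function preserves [Ck]: the hypothesis on [g' \o f] has a smaller order. *)
Lemma Ck_chain (k : nat) {V : normedModType R} (U : set V) (f : V -> R)
    (g g' : R -> R) : open U ->
  (forall x, U x -> is_derive (f x) (1 : R) g (g' (f x))) ->
  Ck k.+1 U f -> Ck k U (g' \o f) -> Ck k.+1 U (g \o f).
Proof.
move=> oU gg' [Df df Cf'] Cg'.
exists (fun x => g' (f x) *: Df x); last exact: Ck_scale.
move=> x Ux; have [dfx dfE] := df x Ux.
have [dg gE] := gg' x Ux.
have dg' : differentiable g (f x) by apply/derivable1_diffP.
split; first exact: differentiable_comp.
rewrite [LHS]diff_comp// dfE; apply/funext => v /=.
by rewrite diff1E// derive1E gE; exact: mulrC.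
Qed.

End BoundedBilinear.

(** * Flat functions, smooth steps and a path of rotations *)

Section Flat.
Context {R : realType}.
Implicit Types (t s : R) (k n : nat).

(** The classical flat function is [flat 0]. The others are there because the
family is stable under differentiation. *)
Definition flat k t : R := if 0 < t then t ^- k * expR (- t^-1) else 0.

Lemma flat_le0 k t : t <= 0 -> flat k t = 0.
Proof. by rewrite /flat leNgt => /negbTE ->. Qed.

Lemma flat_ge0 k t : 0 <= flat k t.
Proof.
rewrite /flat; case: ltP => // t0.
by rewrite mulr_ge0 ?expR_ge0// invr_ge0 exprn_ge0// ltW.
Qed.

(** With y = 1/t and n = k + 2, this is exp y >= (1 + y/n)^n >= (y/n)^n. The
square on the right-hand side gives both the continuity and the vanishing of
the derivative at 0. *)
Lemma flat_bound k : exists2 C, 0 < C & forall t, flat k t <= C * t ^+ 2.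
Proof.
pose n := k.+2; exists (n%:R ^+ n) => [|t]; first by rewrite exprn_gt0.
rewrite /flat; case: ltP => [t0|_]; last first.
  by rewrite mulr_ge0 ?sqr_ge0// exprn_ge0.
have h : (n%:R * t) ^- n <= expR (t^-1).
  have -> : t^-1 = n%:R * (n%:R * t)^-1.
    by rewrite invfM mulrA mulfV ?mul1r// pnatr_eq0.
  rewrite expRM_natl -exprVn; apply: lerXn2r; rewrite ?nnegrE ?expR_ge0//.
    by rewrite invr_ge0 mulr_ge0// ltW.
  by rewrite (le_trans _ (expR_ge1Dx _))// lerDr.
rewrite expRN.
have {h} : (expR t^-1)^-1 <= (n%:R * t) ^+ n.
  by rewrite invf_ple ?posrE ?expR_gt0// exprn_gt0// mulr_gt0// ltr0n.
rewrite exprMn => h; rewrite mulrC ler_pdivrMr ?exprn_gt0//.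
by rewrite -mulrA -exprD addnC addn2.
Qed.

Lemma is_derive_flat k t :
  is_derive t (1 : R) (flat k) (flat k.+2 t - k%:R * flat k.+1 t).
Proof.
have [t0|t0|->] := ltgtP t 0.
- rewrite !flat_le0 ?ltW// mulr0 subr0.
  apply: (@near_eq_is_derive _ R R (cst 0)).
  by near=> x; rewrite flat_le0// ltW//; near: x; exact: lt_nbhsl.
- apply: (@near_eq_is_derive _ R R (fun x => (x^-1) ^+ k * expR (- x^-1))).
    near=> x; rewrite /flat ifT//; last by near: x; exact: lt_nbhsr.
    by rewrite exprVn.
  have tn0 : t != 0 by rewrite gt_eqF.
  have hV : is_derive t (1 : R) (fun x : R => x^-1) (- t ^- 2).
    by apply: is_derive_eq; [exact: is_deriveV|rewrite [LHS]mulr1].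
  have hX : is_derive t (1 : R) (fun x : R => x^-1 ^+ k)
      ((k%:R * t^-1 ^+ k.-1) * - t ^- 2).
    by have := is_deriveX k hV; rewrite exprfctE.
  have hE : is_derive t (1 : R) (fun x : R => expR (- x^-1))
      (expR (- t^-1) * (t ^- 2)).
    have hN : is_derive t (1 : R) (fun x : R => - x^-1) (t ^- 2).
      by apply: is_derive_eq; rewrite opprK.
    exact: (is_derive1_comp (is_derive_expR _) hN).
  have := is_deriveM hX hE; rewrite mulrfctE => /is_derive_eq; apply.
  rewrite /flat !t0 /GRing.scale/=.
  case: k hX => [|k] hX.
    by rewrite !mul0r mulr0 addr0 subr0 expr0 mul1r mulrC.
  rewrite -!exprVn !exprS.
  by rewrite mulr_natl; ring.
- rewrite !flat_le0// mulr0 subr0.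
  have [C C0 hC] := flat_bound k.
  have lim0 : h^-1 *: (flat k (h *: 1 + 0) - flat k 0) @[h --> 0^'] --> (0 : R).
    apply/cvgr0Pnorm_le => e e0.
    near=> h.
    have hn0 : h != 0 by near: h; exact: nbhs_dnbhs_neq.
    rewrite (flat_le0 _ (lexx 0)) subr0 addr0 [h *: 1]mulr1.
    rewrite normrZ normfV ler_pdivrMl ?normr_gt0//.
    rewrite ger0_norm ?flat_ge0// (le_trans (hC _))//.
    rewrite -(real_normK (num_real h)) expr2 mulrCA ler_wpM2l// -ler_pdivlMl//
      mulrC ltW//.
    near: h; apply: dnbhs0_lt; exact: divr_gt0.
  apply: DeriveDef; first by apply/cvg_ex; exists 0.
  exact: cvg_lim.
Unshelve. all: by end_near. Qed.

Lemma flat_continuous k : continuous (flat k).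
Proof.
move=> t; apply: differentiable_continuous; apply/derivable1_diffP.
by have [] := is_derive_flat k t.
Qed.

End Flat.

Section SmoothOp.
Context {R : realType}.

(** Smoothness of a real function, in the form in which it is used: it
preserves every class [Ck] by composition, whatever the source space. *)
Definition smooth_op (g : R -> R) : Prop :=
  forall k (V : normedModType R) (U : set V) (f : V -> R),
    open U -> Ck k U f -> Ck k U (fun x => g (f x)).

Lemma Ck0_comp (V : normedModType R) (U : set V) (f : V -> R) (g : R -> R) :
  open U -> continuous g -> Ck 0 U f -> Ck 0 U (fun x => g (f x)).
Proof.
move=> oU cg /Ck0P-/(_ oU) cf; apply/Ck0P => // x Ux.
by apply: (@continuous_comp _ _ _ f g); [exact: cf|exact: cg].
Qed.

Lemma smooth_op_comp g h : smooth_op g -> smooth_op h ->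
  smooth_op (fun t => g (h t)).
Proof. by move=> sg sh k V U f oU Cf; apply: sg => //; exact: sh. Qed.

Lemma smooth_op_cst c : smooth_op (fun=> c).
Proof. by move=> k V U f oU _; exact: Ck_cst. Qed.

Lemma smooth_op_id : smooth_op id.
Proof. by move=> k V U f oU. Qed.

Lemma smooth_opD g h : smooth_op g -> smooth_op h ->
  smooth_op (fun t => g t + h t).
Proof.
by move=> sg sh k V U f oU Cf; apply: Ck_add => //; [exact: sg|exact: sh].
Qed.

Lemma smooth_opM g h : smooth_op g -> smooth_op h ->
  smooth_op (fun t => g t * h t).
Proof.
by move=> sg sh k V U f oU Cf; apply: Ck_scale => //; [exact: sg|exact: sh].
Qed.

Lemma smooth_op_flat k : smooth_op (flat k).
Proof.
move=> n V U f oU; elim: n k => [|n IH] k Cf.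
  by apply: Ck0_comp => //; exact: flat_continuous.
apply: (Ck_chain (g' := fun t => flat k.+2 t - k%:R * flat k.+1 t) oU
  (fun x _ => is_derive_flat k (f x)) Cf).
apply: (Ck_eq (g := fun x => flat k.+2 (f x) + - k%:R * flat k.+1 (f x)) oU).
  by move=> x _ /=; rewrite mulNr.
apply: Ck_add => //.
- by apply: IH; exact: Ck_le1.
- by apply: Ck_scale => //; [exact: Ck_cst|apply: IH; exact: Ck_le1].
Qed.

Lemma smooth_op_trig : smooth_op sin /\ smooth_op cos.
Proof.
suff h n (V : normedModType R) (U : set V) (f : V -> R) : open U -> Ck n U f ->
    Ck n U (fun x => sin (f x)) /\ Ck n U (fun x => cos (f x)).
  by split=> n V U f oU /h-/(_ oU)[].
move=> oU; elim: n => [|n IH] Cf.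
  by split; apply: Ck0_comp => //;
    [exact: continuous_sin|exact: continuous_cos].
have [Cs Cc] := IH (Ck_le1 oU Cf); split.
  exact: (Ck_chain oU (fun x _ => is_derive_sin (f x)) Cf).
apply: (Ck_chain (g' := fun t : R => - sin t) oU (fun x _ => is_derive_cos (f
  x)) Cf).
apply: (Ck_eq (g := fun x => -1 * sin (f x)) oU) => [x _ /=|].
  by rewrite mulN1r.
by apply: Ck_scale => //; exact: Ck_cst.
Qed.

End SmoothOp.

Section Step.
Context {R : realType}.
Implicit Types (t s : R) (i : nat).

Local Notation e1 := (expR 1 : R).

(** A smooth function equal to 1 on the negative half-line and to 0 beyond 1.
It is obtained without any quotient of functions: [1 - e1 * flat 0 t] is 1 for
[t <= 0] and nonpositive for [t >= 1]. *)
Definition step t : R := e1 * flat 0 (1 - e1 * flat 0 t).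
Definition dstep t : R := - e1 ^+ 2 * (flat 2 (1 - e1 * flat 0 t) * flat 2 t).

Lemma is_derive_flat0 t : is_derive t (1 : R) (flat 0) (flat 2 t).
Proof. by have := is_derive_flat 0 t; rewrite mul0r subr0. Qed.

Lemma is_derive_step t : is_derive t (1 : R) step (dstep t).
Proof.
have h0 := is_deriveB (is_derive_cst (1 : R) t 1)
  (is_deriveZ e1 (is_derive_flat0 t)).
have h1 := @is_derive1_comp _ (flat 0) (cst 1 - e1 \*: flat 0) t _ _
  (is_derive_flat0 (1 - e1 * flat 0 t)) h0.
apply: (is_derive_eq (is_deriveZ e1 h1)).
by rewrite /dstep /GRing.scale/=; ring.
Qed.

Lemma step_le0 t : t <= 0 -> step t = 1.
Proof.
move=> t0; rewrite /step (flat_le0 0 t0) mulr0 subr0 /flat ltr01 expr0 invr1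
  mul1r.
by rewrite -expRD subrr expR0.
Qed.

Lemma step_ge1 t : 1 <= t -> step t = 0.
Proof.
move=> t1; rewrite /step [X in _ * X]flat_le0 ?mulr0// subr_le0.
have t0 : 0 < t by rewrite (lt_le_trans ltr01).
rewrite /flat t0 expr0 invr1 mul1r -expRD -[leLHS]expR0 ler_expR subr_ge0.
by rewrite invf_le1.
Qed.

Lemma step_ge0 t : 0 <= step t.
Proof. by rewrite mulr_ge0 ?expR_ge0 ?flat_ge0. Qed.

Lemma step_le1 t : step t <= 1.
Proof.
have : 1 - e1 * flat 0 t <= 1 by rewrite gerBl mulr_ge0 ?expR_ge0 ?flat_ge0.
rewrite /step; move: (1 - _) => u u1.
rewrite /flat; case: ifPn => [u0|_]; last by rewrite mulr0.
rewrite expr0 invr1 mul1r -expRD -[leRHS]expR0 ler_expR subr_le0.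
by rewrite invf_ge1.
Qed.

Lemma dstep_le0 t : t <= 0 -> dstep t = 0.
Proof. by move=> t0; rewrite /dstep (flat_le0 2 t0) !mulr0. Qed.

Lemma dstep_ge1 t : 1 <= t -> dstep t = 0.
Proof.
move=> t1; rewrite /dstep [flat 2 (_ - _)]flat_le0 ?mul0r ?mulr0//.
rewrite subr_le0.
have t0 : 0 < t by rewrite (lt_le_trans ltr01).
rewrite /flat t0 expr0 invr1 mul1r -expRD -[leLHS]expR0 ler_expR subr_ge0.
by rewrite invf_le1.
Qed.

Lemma dstep_continuous : continuous dstep.
Proof.
move=> t; apply: cvgM; first exact: cvg_cst.
apply: cvgM; last exact: flat_continuous.
apply: (@continuous_comp _ _ _ (fun t => 1 - e1 * flat 0 t) (flat 2));
  last exact: flat_continuous.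
by apply: cvgB; [exact: cvg_cst|apply: cvgM;
  [exact: cvg_cst|exact: flat_continuous]].
Qed.

Lemma smooth_op_step : smooth_op step.
Proof.
apply: smooth_opM; first exact: smooth_op_cst.
apply: (smooth_op_comp (smooth_op_flat 0)).
have : smooth_op (fun t : R => 1 + - e1 * flat 0 t).
  apply: smooth_opD; first exact: smooth_op_cst.
  by apply: smooth_opM; [exact: smooth_op_cst|exact: smooth_op_flat].
by congr smooth_op; apply/funext => t; rewrite mulNr.
Qed.

End Step.

Section Path.
Context {R : realType}.
Implicit Types (t s : R) (i J : nat).

(** The angle [pi / 2 * step t] decreases from pi/2 to 0 as [t] runs from 0 to
1. *)
Definition cosstep t : R := cos (pi / 2 * step t).
Definition sinstep t : R := sin (pi / 2 * step t).
Definition dcosstep t : R := - sinstep t * (pi / 2 * dstep t).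
Definition dsinstep t : R := cosstep t * (pi / 2 * dstep t).

Lemma is_derive_pihalf_step t :
  is_derive t (1 : R) (fun s => pi / 2 * step s) (pi / 2 * dstep t).
Proof. exact: (is_deriveZ (pi / 2) (is_derive_step t)). Qed.

Lemma is_derive_cosstep t : is_derive t (1 : R) cosstep (dcosstep t).
Proof. exact: (is_derive1_comp (is_derive_cos _)
  (is_derive_pihalf_step t)). Qed.

Lemma is_derive_sinstep t : is_derive t (1 : R) sinstep (dsinstep t).
Proof. exact: (is_derive1_comp (is_derive_sin _)
  (is_derive_pihalf_step t)). Qed.

Lemma cosstep_le0 t : t <= 0 -> cosstep t = 0.
Proof. by move=> t0; rewrite /cosstep step_le0// mulr1 cos_pihalf. Qed.

Lemma cosstep_ge1 t : 1 <= t -> cosstep t = 1.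
Proof. by move=> t0; rewrite /cosstep step_ge1// mulr0 cos0. Qed.

Lemma sinstep_le0 t : t <= 0 -> sinstep t = 1.
Proof. by move=> t0; rewrite /sinstep step_le0// mulr1 sin_pihalf. Qed.

Lemma sinstep_ge1 t : 1 <= t -> sinstep t = 0.
Proof. by move=> t0; rewrite /sinstep step_ge1// mulr0 sin0. Qed.

Lemma dcosstep_out t : (t <= 0) || (1 <= t) -> dcosstep t = 0.
Proof.
by move=> /orP[t0|t0]; rewrite /dcosstep ?(dstep_le0 t0) ?(dstep_ge1 t0) !mulr0.
Qed.

Lemma dsinstep_out t : (t <= 0) || (1 <= t) -> dsinstep t = 0.
Proof.
by move=> /orP[t0|t0]; rewrite /dsinstep ?(dstep_le0 t0) ?(dstep_ge1 t0) !mulr0.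
Qed.

Lemma sinstep_sqr t : sinstep t ^+ 2 = 1 - cosstep t ^+ 2.
Proof. exact: sin2cos2. Qed.

Lemma sinstep_dsinstep t : sinstep t * dsinstep t = - (cosstep t * dcosstep t).
Proof. by rewrite /dsinstep /dcosstep; ring. Qed.

Lemma smooth_op_cosstep : smooth_op cosstep.
Proof.
apply: (smooth_op_comp (proj2 smooth_op_trig)).
by apply: smooth_opM; [exact: smooth_op_cst|exact: smooth_op_step].
Qed.

Lemma smooth_op_sinstep : smooth_op sinstep.
Proof.
apply: (smooth_op_comp (proj1 smooth_op_trig)).
by apply: smooth_opM; [exact: smooth_op_cst|exact: smooth_op_step].
Qed.

(** The coefficient of [e i] in the path at time [s]. It increases from 0 to 1
on [i - 1, i], decreases to 0 on [i, i + 1], and vanishes outside; on an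
interval [i, i + 1] only [pathc i] and [pathc i.+1] matter, and they are the
sine and the cosine of one angle. *)
Definition pathc i s : R := cosstep (s - i%:R + 1) * sinstep (s - i%:R).
Definition dpathc i s : R :=
  dcosstep (s - i%:R + 1) * sinstep (s - i%:R) +
  cosstep (s - i%:R + 1) * dsinstep (s - i%:R).

Lemma is_derive_pathc i s : is_derive s (1 : R) (pathc i) (dpathc i s).
Proof.
have h1 : is_derive s (1 : R) (fun t => t - i%:R) 1.
  by apply: is_derive_eq; rewrite subr0.
have h2 : is_derive s (1 : R) (fun t => t - i%:R + 1) 1.
  by apply: is_derive_eq; rewrite addr0.
have hc := @is_derive1_comp _ cosstep (fun t => t - i%:R + 1) s _ _
  (is_derive_cosstep (s - i%:R + 1)) h2.
have hs := @is_derive1_comp _ sinstep (fun t => t - i%:R) s _ _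
  (is_derive_sinstep (s - i%:R)) h1.
have := is_deriveM hc hs; rewrite mulrfctE => /is_derive_eq; apply.
by rewrite /dpathc /GRing.scale/=; ring.
Qed.

Lemma smooth_op_pathc i : smooth_op (pathc i).
Proof.
apply: smooth_opM.
  apply: (smooth_op_comp smooth_op_cosstep); apply: smooth_opD;
    last exact: smooth_op_cst.
  by apply: smooth_opD; [exact: smooth_op_id|exact: smooth_op_cst].
apply: (smooth_op_comp smooth_op_sinstep).
by apply: smooth_opD; [exact: smooth_op_id|exact: smooth_op_cst].
Qed.

Lemma pathc_lt i s : s <= i%:R - 1 -> pathc i s = 0 /\ dpathc i s = 0.
Proof.
move=> h; have h' : s - i%:R + 1 <= 0 by lra.
by rewrite /pathc /dpathc cosstep_le0// dcosstep_out ?h'// !mul0r addr0.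
Qed.

Lemma pathc_gt i s : i%:R + 1 <= s -> pathc i s = 0 /\ dpathc i s = 0.
Proof.
move=> h; have h' : 1 <= s - i%:R by lra.
by rewrite /pathc /dpathc sinstep_ge1// dsinstep_out ?h' ?orbT// !mulr0 addr0.
Qed.

(** At each time one of the two factors of [pathc i] is 1, which makes the
square telescope. *)
Lemma pathc_sqr i s :
  pathc i s ^+ 2 = cosstep (s - i%:R + 1) ^+ 2 - cosstep (s - i.+1%:R + 1) ^+ 2.
Proof.
rewrite (_ : s - i.+1%:R + 1 = s - i%:R); last by rewrite -natr1; ring.
rewrite /pathc exprMn sinstep_sqr.
have [h|h] := lerP (s - i%:R) 0.
  by rewrite (cosstep_le0 h) expr0n/= !subr0 mulr1.
by rewrite [cosstep (_ + 1)]cosstep_ge1 ?expr1n ?mul1r//; lra.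
Qed.

(** This is half the derivative of [pathc_sqr]. *)
Lemma pathc_dpathc i s : pathc i s * dpathc i s =
  cosstep (s - i%:R + 1) * dcosstep (s - i%:R + 1)
  - cosstep (s - i.+1%:R + 1) * dcosstep (s - i.+1%:R + 1).
Proof.
rewrite (_ : s - i.+1%:R + 1 = s - i%:R); last by rewrite -natr1; ring.
rewrite /pathc /dpathc.
have [h|h] := lerP (s - i%:R) 0.
  rewrite (cosstep_le0 h) (sinstep_le0 h) dsinstep_out ?h//.
  by rewrite mulr0 mul0r subr0 addr0 !mulr1.
have h1 : 1 <= s - i%:R + 1 by lra.
rewrite (cosstep_ge1 h1) dcosstep_out ?h1 ?orbT//.
by rewrite mul0r !mul1r !add0r sinstep_dsinstep.
Qed.

Lemma pathc_sum_sqr J s : 0 <= s -> s <= J%:R - 1 ->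
  \sum_(i < J) pathc i s ^+ 2 = 1.
Proof.
move=> s0 sJ; pose F i := - cosstep (s - i%:R + 1) ^+ 2.
rewrite (eq_bigr (fun i : 'I_J => F i.+1 - F i)) => [|i _]; last first.
  by rewrite pathc_sqr /F opprK addrC.
rewrite -(big_mkord xpredT (fun i => F i.+1 - F i)) telescope_sumr// /F.
rewrite cosstep_le0; last by lra.
by rewrite cosstep_ge1 ?expr0n/= ?expr1n ?oppr0 ?add0r ?opprK//; lra.
Qed.

Lemma pathc_sum_dpathc J s : 0 <= s -> s <= J%:R - 1 ->
  \sum_(i < J) pathc i s * dpathc i s = 0.
Proof.
move=> s0 sJ; pose F i := - (cosstep (s - i%:R + 1) * dcosstep (s - i%:R + 1)).
rewrite (eq_bigr (fun i : 'I_J => F i.+1 - F i)) => [|i _]; last first.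
  by rewrite pathc_dpathc /F opprK addrC.
rewrite -(big_mkord xpredT (fun i => F i.+1 - F i)) telescope_sumr// /F.
have eJ : dcosstep (s - J%:R + 1) = 0 by apply: dcosstep_out; apply/orP; left;
  lra.
have e0 : dcosstep (s - 0%:R + 1) = 0 by apply: dcosstep_out; apply/orP;
  right; lra.
by rewrite eJ e0 !mulr0 subrr.
Qed.

End Path.

(** * An orthonormal sequence that is eventually orthogonal to each [d i] *)

Section Dot.
Context {R : realType} {X : normedModType R} (dot : {dot X for @idfun R}).
Implicit Types (u v w x : X).

Lemma dotC u v : dot u v = dot v u.
Proof. by rewrite hermC/= expr0 mul1r. Qed.

Lemma dotDl u v w : dot (u + v) w = dot u w + dot v w.
Proof. exact: linearDl. Qed.

Lemma dotZl (a : R) u w : dot (a *: u) w = a * dot u w.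
Proof. exact: linearZl_LR. Qed.

Lemma dotDr u v w : dot w (u + v) = dot w u + dot w v.
Proof. by rewrite dotC dotDl ![dot _ w]dotC. Qed.

Lemma dotZr (a : R) u w : dot w (a *: u) = a * dot w u.
Proof. by rewrite dotC dotZl dotC. Qed.

Lemma dot0l w : dot 0 w = 0.
Proof. by rewrite -(scale0r (0 : X)) dotZl mul0r. Qed.

Lemma dot0r w : dot w 0 = 0.
Proof. by rewrite dotC dot0l. Qed.

Lemma dotBl u v w : dot (u - v) w = dot u w - dot v w.
Proof. by rewrite dotDl -scaleN1r dotZl mulN1r. Qed.

Lemma dotBr u v w : dot w (u - v) = dot w u - dot w v.
Proof. by rewrite dotC dotBl ![dot _ w]dotC. Qed.

Lemma dot_suml (I : Type) (r : seq I) (P : pred I) (F : I -> X) w :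
  dot (\sum_(i <- r | P i) F i) w = \sum_(i <- r | P i) dot (F i) w.
Proof. by apply: (big_morph (dot^~ w)) => [a b|]; rewrite ?dotDl ?dot0l. Qed.

Lemma dot_sumr (I : Type) (r : seq I) (P : pred I) (F : I -> X) w :
  dot w (\sum_(i <- r | P i) F i) = \sum_(i <- r | P i) dot w (F i).
Proof. by apply: (big_morph (dot w)) => [a b|]; rewrite ?dotDr ?dot0r. Qed.

Lemma dot_gt0 u : u != 0 -> 0 < dot u u.
Proof. exact: neq0_dnorm_gt0. Qed.

Lemma dot_ge0 u : 0 <= dot u u.
Proof. by have [->|/dot_gt0/ltW//] := eqVneq u 0; rewrite dot0l. Qed.

Hypothesis hdot : norm_of_inner_product dot.

Lemma dotvv u : dot u u = `|u| ^+ 2.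
Proof. by rewrite hdot sqr_sqrtr// dot_ge0. Qed.

Lemma dot_CS u v : `|dot u v| <= `|u| * `|v|.
Proof.
have [->|v0] := eqVneq v 0; first by rewrite dot0r !normr0 mulr0.
have vv0 := dot_gt0 v0.
have h := dot_ge0 (dot v v *: u - dot u v *: v).
have {}h : 0 <= dot v v * (dot u u * dot v v - dot u v ^+ 2).
  rewrite dotBl !dotBr !dotZl !dotZr in h.
  by rewrite [dot v u]dotC in h; move: h; congr (_ <= _); ring.
rewrite pmulr_rge0// subr_ge0 !dotvv -exprMn in h.
rewrite -(@ler_sqr R) ?nnegrE ?mulr_ge0//.
by rewrite real_normK// num_real.
Qed.

Lemma dot_bounded_bilinear : bounded_bilinear (dot : X -> X -> R).
Proof.
split=> [w a u v|w a u v|]; first by rewrite dotDl dotZl.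
  by rewrite dotDr dotZr.
by exists 1 => u w; rewrite mul1r dot_CS.
Qed.

(** Gram-Schmidt. That [s] lies in the span of [l] is expressed by duality. *)
Lemma orthonormal_seq_orth (s : seq X) : exists l : seq X,
  (forall i j, (i < size l)%N -> (j < size l)%N ->
    dot l`_i l`_j = (i == j)%:R) /\
  (forall v, (forall i, (i < size l)%N -> dot l`_i v = 0) ->
     forall u, u \in s -> dot u v = 0).
Proof.
elim: s => [|a s [l [lo ls]]]; first by exists [::].
pose a' := a - \sum_(i < size l) dot l`_i a *: l`_i.
have a'l i : (i < size l)%N -> dot l`_i a' = 0.
  move=> io; rewrite dotBr dot_sumr (bigD1 (Ordinal io))//=.
  rewrite big1 => [|j /negbTE ji].
    by rewrite dotZr lo// eqxx mulr1 addr0 subrr.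
  by rewrite dotZr lo// eq_sym; move: ji; rewrite -val_eqE/= => ->;
    rewrite mulr0.
have aE v : (forall i, (i < size l)%N -> dot l`_i v = 0) -> dot a v = dot a' v.
  move=> ov; rewrite dotBl dot_suml big1 ?subr0// => i _.
  by rewrite dotZl ov ?mulr0.
have [a'0|a'0] := eqVneq a' 0.
  exists l; split => // v ov u; rewrite inE => /orP[/eqP->|]; last exact: ls.
  by rewrite aE// a'0 dot0l.
pose e := `|a'|^-1 *: a'.
exists (e :: l); split=> [[|i] [|j] //= io jo|v ov u].
- by rewrite dotZl dotZr dotvv expr2 !mulKf ?mulVf ?normr_eq0.
- by rewrite dotZl dotC a'l ?mulr0.
- by rewrite dotZr a'l ?mulr0.
- by rewrite lo// eqSS.
have ov' i : (i < size l)%N -> dot l`_i v = 0 by move=> io; exact: (ov i.+1).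
rewrite inE => /orP[/eqP->|]; last exact: ls.
rewrite aE//; have := ov 0%N isT; rewrite /= dotZl => /eqP.
by rewrite mulf_eq0 invr_eq0 normr_eq0 (negbTE a'0) => /eqP.
Qed.

(** Infinite dimension enters here only: were every vector its own projection
to the span of [l], then [l] would span the space. *)
Lemma unit_vector_orth (s : seq X) : ~ finite_dimensional X ->
  exists e, dot e e = 1 /\ forall u, u \in s -> dot u e = 0.
Proof.
move=> hdim; have [l [lo ls]] := orthonormal_seq_orth s.
have [v vP] : exists v, v != \sum_(i < size l) dot l`_i v *: l`_i.
  apply: contrapT => nv; apply: hdim; exists l => v.
  exists (fun i => dot l`_i v); apply: contrapT => h; apply: nv; exists v.
  exact/eqP.
rewrite -subr_eq0 in vP; set w := (X in X != 0) in vP.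
exists (`|w|^-1 *: w); split.
  by rewrite dotZl dotZr dotvv expr2 !mulKf ?mulVf ?normr_eq0.
move=> u /(ls w) uw; rewrite dotZr uw ?mulr0// => i io.
rewrite dotBr dot_sumr (bigD1 (Ordinal io))//= big1 => [|j /negbTE ji].
  by rewrite dotZr lo// eqxx mulr1 addr0 subrr.
by rewrite dotZr lo// eq_sym; move: ji; rewrite -val_eqE/= => ->; rewrite mulr0.
Qed.

(** Each [e n] is chosen orthogonal to the previous ones and to [d 0], ..., [d
n]. *)
Lemma orthonormal_sequence (d : nat -> X) : ~ finite_dimensional X ->
  exists e : nat -> X,
    (forall i j, dot (e i) (e j) = (i == j)%:R) /\
    (forall i j, (i <= j)%N -> dot (d i) (e j) = 0).
Proof.
move=> hdim; have [c cP] := choice (fun s => unit_vector_orth s hdim).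
pose E := fix E n := if n is m.+1 then c (E m ++ mkseq d m.+1) :: E m else [::].
pose e n := c (E n ++ mkseq d n.+1).
have eE i n : (i < n)%N -> e i \in E n.
  elim: n => // n IH; rewrite ltnS leq_eqVlt => /orP[/eqP->|/IH h].
    by rewrite mem_head.
  by rewrite inE h orbT.
have eo i j : (i < j)%N -> dot (e i) (e j) = 0.
  by move=> ij; apply: (cP _).2; rewrite mem_cat eE.
exists e; split=> [i j|i j ij].
  have [ij|ij|->] := ltngtP i j; first by rewrite eo.
    by rewrite dotC eo.
  exact: (cP _).1.
by apply: (cP _).2; rewrite mem_cat map_f ?orbT// mem_iota.
Qed.

End Dot.

(** * Functions with radial gradient *)

Section Radial.
Context {R : realType} {X : normedModType R} (dot : {dot X for @idfun R}).
Hypothesis hdot : norm_of_inner_product dot.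
Variable d : nat -> X.
Implicit Types (U W : set X) (q r : X -> R) (N : nat) (x v : X).

Definition orth_upto N v := forall i, (i <= N)%N -> dot (d i) v = 0.

Lemma orth_upto_le N M v : (N <= M)%N -> orth_upto M v -> orth_upto N v.
Proof. by move=> NM h i iN; apply: h; exact: leq_trans NM. Qed.

(** The gradient of [q] at [x] is [lam x] times [x] modulo the span of [d 0],
..., [d N]. This is expressed by duality, on the vectors orthogonal to that
span, so that neither the span nor the gradient has to be considered. The
continuity of [lam] is what makes it locally bounded. *)
Definition radial N W q := Cinfty W q /\
  exists lam : X -> R, (forall x, W x -> {for x, continuous lam}) /\
    forall x, W x -> forall v, orth_upto N v -> 'd q x v = lam x * dot x v.

Lemma Cinfty_differentiable W q x :
  Cinfty W q -> W x -> differentiable q x.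
Proof. by move=> /(_ 1%N) [Dq dq _] /dq[]. Qed.

Lemma radial_diff N W q x : radial N W q -> W x -> differentiable q x.
Proof. by case=> + _; exact: Cinfty_differentiable. Qed.

Lemma radial_continuous N W q x : radial N W q -> W x -> {for x, continuous q}.
Proof. by move=> h Wx; apply: differentiable_continuous;
  exact: (radial_diff h Wx). Qed.

Lemma radial_sub N M W U q : open W -> open U -> W `<=` U -> (N <= M)%N ->
  radial N U q -> radial M W q.
Proof.
move=> oW oU WU NM [Cq [lam [clam dq]]]; split; first by move=> k;
  exact: Ck_sub (Cq k).
exists lam; split=> [x /WU/clam//|x /WU Ux v ov].
by apply: dq => //; exact: orth_upto_le ov.
Qed.

Lemma radial_eq N W q r : open W -> (forall x, W x -> q x = r x) ->
  radial N W r -> radial N W q.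
Proof.
move=> oW qr h; have [Cr [lam [clam dr]]] := h.
split; first by move=> k; exact: Ck_eq (Cr k).
exists lam; split=> // x Wx v ov; rewrite -(dr x Wx v ov).
have [_ ->//] : is_diff x q ('d r x).
apply: is_diff_germ; last exact: (radial_diff h Wx).
by near=> y; apply: qr; near: y; exact: open_nbhs_nbhs.
Unshelve. all: by end_near. Qed.

Lemma radial_cst N W c : open W -> radial N W (cst c).
Proof.
move=> oW; split; first by move=> k; exact: Ck_cst.
exists (fun=> 0); split=> [x _|x _ v _]; first exact: cvg_cst.
by rewrite diff_cst mul0r.
Qed.

Lemma radialD N W q r : open W -> radial N W q -> radial N W r ->
  radial N W (fun x => q x + r x).
Proof.
move=> oW hq hr; have [Cq [l [cl dq]]] := hq; have [Cr [m [cm dr]]] := hr.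
split; first by move=> k; exact: Ck_add.
exists (fun x => l x + m x); split=> [x Wx|x Wx v ov].
  by apply: cvgD; [exact: cl|exact: cm].
rewrite [LHS](congr1 (fun f => f v) (diffD (radial_diff hq Wx)
  (radial_diff hr Wx))).
by rewrite /= dq// dr// mulrDl.
Qed.

Lemma radialM N W q r : open W -> radial N W q -> radial N W r ->
  radial N W (fun x => q x * r x).
Proof.
move=> oW hq hr; have [Cq [l [cl dq]]] := hq; have [Cr [m [cm dr]]] := hr.
split; first by move=> k; apply: Ck_scale.
exists (fun x => q x * m x + r x * l x); split=> [x Wx|x Wx v ov].
  by apply: cvgD; apply: cvgM; [exact: (radial_continuous hq Wx)|exact: cm|
    exact: (radial_continuous hr Wx)|exact: cl].
rewrite [LHS](congr1 (fun f => f v) (diffM (radial_diff hq Wx)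
  (radial_diff hr Wx))).
rewrite -[LHS]/(q x * 'd r x v + r x * 'd q x v) dq// dr//.
by rewrite mulrDl !mulrA.
Qed.

Lemma radial_comp N W q (g g' : R -> R) : open W -> smooth_op g ->
  (forall t, is_derive t (1 : R) g (g' t)) -> continuous g' ->
  radial N W q -> radial N W (fun x => g (q x)).
Proof.
move=> oW sg gg' cg' hq; have [Cq [l [cl dq]]] := hq.
split; first by move=> k; exact: sg.
exists (fun x => g' (q x) * l x); split=> [x Wx|x Wx v ov].
  apply: cvgM; last exact: cl.
  by apply: (@continuous_comp _ _ _ q g');
    [exact: (radial_continuous hq Wx)|exact: cg'].
have [dg gE] := gg' (q x).
have dg' : differentiable g (q x) by apply/derivable1_diffP.
rewrite [LHS](congr1 (fun f => f v) (diff_comp (radial_diff hq Wx) dg')) /=.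
rewrite dq// diff1E// derive1E gE.
by rewrite /GRing.scale/= mulrC mulrA.
Qed.

Lemma radial_sum N W (I : Type) (s : seq I) (q : I -> X -> R) : open W ->
  (forall i, radial N W (q i)) -> radial N W (fun x => \sum_(i <- s) q i x).
Proof.
move=> oW hq; elim: s => [|i s IH].
  by apply: (radial_eq oW) (radial_cst N 0 oW) => x _; rewrite big_nil.
by apply: (radial_eq oW) (radialD oW (hq i) IH) => x _; rewrite big_cons.
Qed.

(** The derivative is [v |-> 2 * dot (x - d i) v]. *)
Lemma radial_sqdist N W i : open W -> (i <= N)%N ->
  radial N W (fun x => dot (x - d i) (x - d i)).
Proof.
move=> oW iN; have bd := dot_bounded_bilinear hdot.
have idc : (id : X -> X) \in @clin R X X.
  by apply: bounded_linear_clin => //; exists 1 => v; rewrite mul1r.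
have Cid k : Ck k W (fun x : X => x - d i).
  by apply: Ck_add => //; [exact: (Ck_linear k (CLinear idc) oW)|exact: Ck_cst].
split; first by move=> k; apply: Ck_bilinear.
exists (fun=> 2); split=> [x _|x Wx v ov]; first exact: cvg_cst.
have di : is_diff x (fun x : X => x - d i) id.
  apply: is_diff_eq; apply/funext => u /=; rewrite !fctE.
  by rewrite subr0.
have [_ ->] := is_diff_bounded_bilinear bd di di.
by rewrite dotBr dotBl [dot v (d i)]dotC ov// subr0 [dot v x]dotC; ring.
Qed.

Definition locally_radial U q := forall x, U x ->
  exists N (W : set X), [/\ open W, W x & radial N W q].

Lemma locally_radial_Cinfty U q : open U -> locally_radial U q -> Cinfty U q.
Proof.
move=> oU h k; apply: Ck_local => // x /h[N [W [oW Wx [C _]]]].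
by exists W, q; split.
Qed.

End Radial.

(** * Locally radial functions from local data *)

Section Covers.
Context {R : realType} {X : normedModType R} (dot : {dot X for @idfun R}).
Hypothesis hdot : norm_of_inner_product dot.
Variable d : nat -> X.
Hypothesis d_dense : forall x (e : R), 0 < e -> exists i, `|x - d i| < e.
Variable U : set X.
Local Notation radial := (radial dot d).
Local Notation locally_radial := (locally_radial dot d).
Local Notation orth_upto := (orth_upto dot d).

(** The balls with centre some [d i] and radius [2 / m.+1] on which [P] holds
still cover [U], even after halving their radii, since [d] is dense; and they
are countably many. The others are discarded by giving them the zero bump. *)
Lemma bump_cover (P : set X -> Prop) :
  (forall A B : set X, A `<=` B -> P B -> P A) ->
  (forall x, U x -> exists2 r : R, 0 < r & P (ball x r)) ->
  exists (N : nat -> nat) (b : nat -> X -> R) (B : nat -> set X),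
    [/\ forall n, radial (N n) setT (b n),
        forall n x, 0 <= b n x <= 1,
        forall n x, b n x != 0 -> P (B n) /\ B n x
      & forall x, U x -> exists n, \forall y \near x, b n y = 1].
Proof.
move=> Psub Ploc.
(* The n-th ball has centre d (code n).1; its bump is 1 on the ball of radius
   r n, and its support lies in the ball of radius 2 * r n. *)
pose code n : nat * nat := odflt (0, 0)%N (unpickle n).
pose c n := d (code n).1; pose r n : R := (code n).2.+1%:R^-1.
have r0 n : 0 < r n by rewrite invr_gt0.
pose B n : set X := ball (c n) (2 * r n).
pose ok n := `[< P (B n) >].
pose b n x := (ok n)%:R * step (r n ^- 2 * dot (x - c n) (x - c n) + -1).
exists (fun n => (code n).1), b, B; split=> [n|n x|n x|x Ux].
- have oT : open (@setT X) by exact: openT.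
  apply: (radialM oT); first exact: radial_cst.
  apply: (radial_comp oT smooth_op_step is_derive_step dstep_continuous).
  apply: (radialD oT); last exact: radial_cst.
  apply: (radialM oT); first exact: radial_cst.
  exact: radial_sqdist.
- rewrite /b; case: (ok n); rewrite ?mul0r ?lexx ?ler01//.
  by rewrite mul1r step_ge0 step_le1.
- rewrite /b; have [okn|] := boolP (ok n); last by rewrite mul0r eqxx.
  rewrite mul1r => bx; split; first exact/asboolP.
  rewrite /B -ball_normE /= distrC.
  rewrite ltNge; apply: contra bx => hx; apply/eqP/step_ge1.
  rewrite dotvv//.
  have h2 : (2 * r n) ^+ 2 <= `|x - c n| ^+ 2.
    by rewrite ler_sqr ?nnegrE// mulr_ge0// ltW.
  rewrite lerBrDr -[leLHS]/(2%:R) mulrC ler_pdivlMr ?exprn_gt0//.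
  rewrite (le_trans _ h2)// exprMn ler_wpM2r ?sqr_ge0//.
  by rewrite -natrX ler_nat.
- have [e e0 Pe] := Ploc x Ux.
  have [m me] : exists m, 3 * m.+1%:R^-1 < e.
    exists (Num.truncn (3 / e)); rewrite ltr_pdivrMr// mulrC -ltr_pdivrMr//.
    by rewrite truncnS_gt.
  have [i xi] := @d_dense x (m.+1%:R^-1) ltac:(by rewrite invr_gt0).
  pose n := pickle (i, m).
  have codeE : code n = (i, m) by rewrite /code pickleK.
  have cE : c n = d i by rewrite /c codeE.
  have rE : r n = m.+1%:R^-1 by rewrite /r codeE.
  have okn : ok n.
    apply/asboolP; apply: Psub Pe => y; rewrite /B -!ball_normE /= cE rE => hy.
    rewrite (_ : x - y = (x - d i) + (d i - y)); last by rewrite addrA subrK.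
    rewrite (le_lt_trans (ler_normD _ _))// (lt_trans _ me)//.
    rewrite (_ : 3 * m.+1%:R^-1 = m.+1%:R^-1 + 2 * m.+1%:R^-1); last by ring.
    exact: ltrD.
  exists n; near=> y.
  rewrite /b okn mul1r; apply: step_le0; rewrite subr_le0 dotvv//.
  rewrite mulrC ler_pdivrMr ?exprn_gt0// mul1r ler_sqr ?nnegrE//;
    last exact: ltW.
  rewrite cE rE ltW// distrC.
  near: y.
  have : ball (d i) m.+1%:R^-1 x by rewrite -ball_normE /= distrC.
  move=> hb; have := open_nbhs_nbhs (conj (ball_open (d i)
    (m.+1%:R^-1 : R)) hb).
  by apply: filterS => y; rewrite -ball_normE.
Unshelve. all: by end_near. Qed.

Section Blend.
Variables (b : nat -> X -> R) (c : nat -> R).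

(** This is the sum over [n] of [c n * b n x] times the product of [1 - b m x]
for [m] before [n]: a partition of unity for which no division is needed, and
which is locally finite because all terms after one with [b n x = 1] vanish. *)
Fixpoint blend (s : seq nat) x : R :=
  if s is n :: s' then b n x * c n + (1 - b n x) * blend s' x else 0.

Lemma blend_cat s s' x n : n \in s -> b n x = 1 ->
  blend (s ++ s') x = blend s x.
Proof.
elim: s => // m s IH; rewrite inE => /orP[/eqP<- /= ->|ns bn /=].
  by rewrite subrr !mul0r.
by rewrite IH.
Qed.

Lemma blend_convex (T : R -> Prop) s x n :
  (forall t a e, 0 <= t <= 1 -> T a -> T e -> T (t * a + (1 - t) * e)) ->
  (forall m, 0 <= b m x <= 1) -> (forall m, b m x != 0 -> T (c m)) ->
  n \in s -> b n x = 1 -> T (blend s x).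
Proof.
move=> cT b01 bT; elim: s => // m s IH; rewrite inE.
have [bm1 _ _|bm1] := eqVneq (b m x) 1.
  by rewrite /= bm1 mul1r subrr mul0r addr0; apply: bT; rewrite bm1 oner_neq0.
move=> /orP[/eqP-> bm|ns bn /=]; first by rewrite bm eqxx in bm1.
have [bm0|bm0] := eqVneq (b m x) 0.
  by rewrite bm0 mul0r subr0 add0r mul1r; exact: IH.
by apply: cT => //; [exact: bT|exact: IH].
Qed.

Lemma radial_blend N W s : open W ->
  (forall n, n \in s -> radial N W (b n)) -> radial N W (blend s).
Proof.
move=> oW; elim: s => [_|n s IH h]; first exact: radial_cst.
apply: (radialD oW).
  by apply: (radialM oW); [apply: h; rewrite mem_head|exact: radial_cst].
apply: (radialM oW); last by apply: IH => m ms; apply: h; rewrite inE ms orbT.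
apply: (radial_eq (r := fun x => 1 + -1 * b n x) oW) => [x _|].
  by rewrite mulN1r.
apply: (radialD oW); first exact: radial_cst.
by apply: (radialM oW); [exact: radial_cst|apply: h; rewrite mem_head].
Qed.

End Blend.

(** A selection theorem in the style of Michael: local constant selections of a
convex-valued relation are glued by [blend]. *)
Lemma radial_selection (T : X -> R -> Prop) :
  (forall x t a e, 0 <= t <= 1 -> T x a -> T x e ->
    T x (t * a + (1 - t) * e)) ->
  (forall x, U x -> exists (r c : R), 0 < r /\ forall y, ball x r y -> T y c) ->
  exists F : X -> R, locally_radial U F /\ forall x, U x -> T x (F x).
Proof.
move=> cT Tloc.
pose P (A : set X) := exists c, forall y, A y -> T y c.
have [|x /Tloc[r [c [r0 h]]]|N [b [B [rb b01 bB b1]]]] := @bump_cover P.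
- by move=> A A' AA' [c h]; exists c => y /AA'; exact: h.
- by exists r => //; exists c.
pose c n := if pselect (P (B n)) is left h then projT1 (cid h) else 0.
have cP n x : b n x != 0 -> T x (c n).
  move=> /bB[PB Bx]; rewrite /c; case: pselect => // h.
  by case: cid => /= e; apply.
pose Fn n := blend b c (iota 0 n.+1).
have FnE n m x : b n x = 1 -> (n <= m)%N -> Fn m x = Fn n x.
  move=> bn nm; rewrite /Fn (_ : m.+1 = n.+1 + (m - n))%N;
    last by rewrite addSn subnKC.
  by rewrite iotaD; apply: blend_cat bn; rewrite mem_iota add0n ltnSn.
pose nx x := xget 0%N [set n | b n x = 1].
have FE n x : b n x = 1 -> Fn (nx x) x = Fn n x.
  move=> bn; have bx : b (nx x) x = 1 by rewrite /nx; case: xgetP => // /(_ n).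
  by rewrite -(FnE _ (maxn (nx x) n) _ bx) ?leq_maxl// (FnE n)// leq_maxr.
exists (fun x => Fn (nx x) x); split=> x Ux; have [n bn] := b1 x Ux.
  pose W := [set y : X | \forall z \near y, b n z = 1].
  have oW : open W by exact: open_interior.
  exists (\max_(i < n.+1) N i)%N, W; split => //.
  apply: (radial_eq (r := Fn n) oW) => [y /nbhs_singleton/FE//|].
  apply: radial_blend => // i; rewrite mem_iota add0n => /= i_n.
  apply: (radial_sub oW openT (@subsetT _ _) _ (rb i)).
  exact: (leq_bigmax (F := fun i : 'I_n.+1 => N i) (Ordinal i_n)).
have bnx : b n x = 1 := nbhs_singleton bn.
rewrite (FE n x bnx).
apply: (@blend_convex _ _ _ _ _ n) => //.
- exact: cT.
- by move=> m; exact: cP.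
- by rewrite mem_iota add0n ltnSn.
Qed.

(** The sets [O n] where the sum [S n] of the first bumps exceeds [2 ^- n] are
open and increase to [U]. The cutoff [sg n] depends on these bumps only,
vanishes on [O n], and is 1 outside [O n.+1]. Therefore the series [u] of the
[sg k] with coefficients [M k.+2 + 1] reduces, on [O n], to its terms of rank
less than [n] and a constant, whose gradients are radial modulo [d 0], ..., [d
(M n)]; while outside [O n.-1] its term of rank [n - 2] is at least [M n + 1].
For a point of [O n] that is not in [O n.-1], this says that [u] exceeds the
indices occurring in its own gradient. *)
Lemma radial_exhaustion (G : X -> nat -> Prop) :
  (forall x m m', (m <= m')%N -> G x m -> G x m') ->
  (forall x, U x -> exists (r : R) m, 0 < r /\ forall y, ball x r y -> G y m) ->
  exists u : X -> R, locally_radial U u /\ forall x, U x ->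
    exists M lam, [/\ M.+1%:R <= u x, G x M
      & forall v, orth_upto M v -> 'd u x v = lam * dot x v].
Proof.
move=> Gle Gloc.
pose P (A : set X) := exists m, forall y, A y -> G y m.
have [|x /Gloc[r [m [r0 h]]]|N [b [B [rb b01 bB b1]]]] := @bump_cover P.
- by move=> A A' AA' [m h]; exists m => y /AA'; exact: h.
- by exists r => //; exists m.
pose mm n := if pselect (P (B n)) is left h then projT1 (cid h) else 0%N.
have mmP n x : b n x != 0 -> G x (mm n).
  move=> /bB[PB Bx]; rewrite /mm; case: pselect => // h.
  by case: cid => /= e; apply.
pose S n x := \sum_(i < n.+1) b i x.
have S0 n x : 0 <= S n x by apply: sumr_ge0 => i _; case/andP: (b01 i x).
have SS n x : S n x <= S n.+1 x.
  by rewrite {2}/S big_ord_recr /= lerDl; case/andP: (b01 n.+1 x).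
pose O n : set X := [set x | 1 < 2 ^+ n * S n x].
have OS n x : O n x -> O n.+1 x.
  rewrite /O /= => /lt_le_trans; apply.
  rewrite exprS -mulrA (le_trans (_ : _ <= 2 ^+ n * S n.+1 x))//.
    by rewrite ler_wpM2l// exprn_ge0.
  by rewrite ler_peMl ?ler1n// mulr_ge0// exprn_ge0.
have Ole n m x : (n <= m)%N -> O n x -> O m x.
  by move=> /subnKC <-; elim: (m - n)%N => [|k IH];
    rewrite ?addn0// addnS => /IH/OS.
pose M n := (\sum_(i < n.+1) (N i + mm i))%N.
have Mge n i : (i <= n)%N -> (N i + mm i <= M n)%N.
  by move=> i_n; rewrite /M (bigD1 (Ordinal (i_n : (i < n.+1)%N)))//= leq_addr.
have rS n W k : open W -> (k <= n)%N -> radial (M n) W (S k).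
  move=> oW kn; apply: (radial_sum _ (q := fun i : 'I_k.+1 => b i)) => // i.
  apply: (radial_sub oW openT (@subsetT _ _) _ (rb i)).
  by rewrite (leq_trans (leq_addr (mm i) _))// Mge// (leq_trans _ kn)// -ltnS.
pose sg n x := step (2 * (2 ^+ n * S n x) + -1).
have sg0 n x : 0 <= sg n x by exact: step_ge0.
have sgO n x : O n x -> sg n x = 0.
  by rewrite /O /= => h; apply: step_ge1; lra.
have sgN n x : ~ O n.+1 x -> sg n x = 1.
  move=> /negP; rewrite -leNgt exprS => h; apply: step_le0.
  have := SS n x; have : 0 <= (2 : R) ^+ n by rewrite exprn_ge0.
  move=> p0 /(ler_wpM2l p0); lra.
have rsg n W k : open W -> (k <= n)%N -> radial (M n) W (sg k).
  move=> oW kn.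
  apply: (radial_comp oW smooth_op_step is_derive_step dstep_continuous).
  apply: (radialD oW); last exact: radial_cst.
  apply: (radialM oW); first exact: radial_cst.
  by apply: (radialM oW); [exact: radial_cst|exact: rS].
(* The constant term takes care of the points of O 0 and O 1. *)
pose un n x : R := (M 1%N).+1%:R + \sum_(k < n) (M k.+2).+1%:R * sg k x.
have run n W : open W -> radial (M n) W (un n).
  move=> oW; apply: (radialD oW); first exact: radial_cst.
  apply: (radial_sum _ (q := fun (i : 'I_n) x => (M i.+2).+1%:R * sg i x)) =>
    // i.
  by apply: (radialM oW); [exact: radial_cst|apply: rsg => //; exact: ltnW].
have unE n m x : O n x -> (n <= m)%N -> un m x = un n x.
  move=> On nm; rewrite /un; congr (_ + _).
  rewrite -!(big_mkord xpredT (fun k => (M k.+2).+1%:R * sg k x)).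
  rewrite (big_cat_nat (n := n))//= -[RHS]addr0; congr (_ + _).
  rewrite big_nat big1// => k /andP[nk _].
  by rewrite sgO ?mulr0//; exact: Ole On.
pose nx x := xget 0%N [set n | O n x].
have unxE n x : O n x -> un (nx x) x = un n x.
  move=> On; have Ox : O (nx x) x by rewrite /nx; case: xgetP => // /(_ n).
  by rewrite -(unE _ (maxn (nx x) n) _ Ox) ?leq_maxl// (unE n)// leq_maxr.
have oO n : open (O n).
  apply: (@open_comp _ _ (fun x => 2 ^+ n * S n x) [set t | 1 < t]);
    last exact: open_gt.
  move=> x _; apply: cvgM; first exact: cvg_cst.
  by apply: (radial_continuous (rS n setT n openT (leqnn n))).
have OU x : U x -> exists n, O n x.
  move=> /b1[n /nbhs_singleton bn]; exists n.+1; rewrite /O /=.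
  have Sn : 1 <= S n.+1 x.
    rewrite (le_trans _ (SS n x))// /S big_ord_recr/= bn lerDr.
    by apply: sumr_ge0 => i _; case/andP: (b01 i x).
  rewrite (lt_le_trans (_ : 1 < 2 ^+ n.+1))//;
    first by rewrite exprn_egt1// ltr1n.
  by rewrite ler_peMr// exprn_ge0.
exists (fun x => un (nx x) x).
have ruO n : radial (M n) (O n) (fun x => un (nx x) x).
  by apply: (radial_eq (oO n) _ (run n _ (oO n))) => y /unxE.
split=> x Ux; first by have [n On] := OU x Ux; exists (M n), (O n).
have exO : exists n, 1 < 2 ^+ n * S n x by have [n] := OU x Ux; exists n.
case: (ex_minnP exO) => n On nmin.
have [_ [lam [_ dlam]]] := ruO n.
exists (M n), (lam x); split; last by move=> v; exact: dlam.
  rewrite (unxE n)// /un.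
  have t0 k : 0 <= (M k.+2).+1%:R * sg k x by rewrite mulr_ge0.
  case: n On nmin {dlam} => [|[|n]] On nmin.
  - by rewrite big_ord0 addr0 ler_nat ltnS {1}/M big_ord_recl big_ord0 addn0
    Mge.
  - by rewrite lerDl sumr_ge0.
  have sg1 : sg n x = 1 by apply: sgN => /nmin; rewrite ltnn.
  rewrite big_ord_recr/= big_ord_recr/= sg1 mulr1.
  have p1 : 0 <= \sum_(k < n) (M k.+2).+1%:R * sg k x by rewrite sumr_ge0.
  have p2 := t0 n.+1; have p3 : (0 : R) <= (M 1%N).+1%:R by [].
  lra.
have [i i_n bi] : exists2 i, (i <= n)%N & b i x != 0.
  apply: contrapT => h; move: On; rewrite /S big1 ?mulr0 ?ltr10// => i _.
  apply/eqP/negPn/negP => bi; apply: h; exists i => //.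
  by rewrite -ltnS.
by apply: Gle (mmP _ _ bi); rewrite (leq_trans (leq_addl (N i) _))// Mge.
Qed.

End Covers.

(** * Removing the critical points *)

Section Rotation.
Context {R : realType} {X : normedModType R} (dot : {dot X for @idfun R}).
Hypothesis hdot : norm_of_inner_product dot.
Variable e : nat -> X.
Hypothesis e_orthonormal : forall i j, dot (e i) (e j) = (i == j)%:R.
Implicit Types (s : R) (J : nat) (x v : X).

(** At a time [s <= J - 1] the terms of rank at least [J] vanish, so [J] is
only a truncation ([path_stable]). *)
Definition path J s : X := \sum_(i < J) pathc i s *: e i.
Definition dpath J s : X := \sum_(i < J) dpathc i s *: e i.

Lemma dot_orthonormal J (a c : nat -> R) :
  dot (\sum_(i < J) a i *: e i)
    (\sum_(i < J) c i *: e i) = \sum_(i < J) a i * c i.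
Proof.
rewrite dot_suml; apply: eq_bigr => i _; rewrite dotZl dot_sumr (bigD1 i)//=.
rewrite big1 => [|j /negbTE ji].
  by rewrite dotZr e_orthonormal eqxx mulr1 addr0.
by rewrite dotZr e_orthonormal eq_sym -val_eqE/= in ji *; rewrite ji mulr0.
Qed.

Lemma path_unit J s : 0 <= s -> s <= J%:R - 1 -> dot (path J s) (path J s) = 1.
Proof.
move=> s0 sJ; rewrite [LHS](dot_orthonormal J (pathc^~ s)
  (pathc^~ s)) -[RHS](pathc_sum_sqr s0 sJ).
by apply: eq_bigr => i _; rewrite expr2.
Qed.

Lemma path_dpath J s : 0 <= s -> s <= J%:R - 1 ->
  dot (dpath J s) (path J s) = 0.
Proof.
move=> s0 sJ; rewrite dotC [LHS](dot_orthonormal J (pathc^~ s) (dpathc^~ s)).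
exact: pathc_sum_dpathc.
Qed.

Lemma path_stable J K s : s <= J%:R - 1 -> (J <= K)%N -> path K s = path J s.
Proof.
move=> sJ JK; rewrite /path -!(big_mkord xpredT (fun i => pathc i s *: e i)).
rewrite (big_cat_nat (n := J))//= -[RHS]addr0; congr (_ + _).
rewrite big_nat big1// => i /andP[Ji _].
have [->] : pathc i s = 0 /\ dpathc i s = 0; last by rewrite scale0r.
apply: pathc_lt; rewrite (le_trans sJ)// lerD2r ler_nat//.
Qed.

Lemma path_orth (d : nat -> X) M J s :
  (forall i j, (i <= j)%N -> dot (d i) (e j) = 0) -> M.+1%:R <= s ->
  orth_upto dot d M (path J s) /\ orth_upto dot d M (dpath J s).
Proof.
move=> de Ms; split=> i iM; rewrite dot_sumr big1// => j _; rewrite dotZr;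
  (have [ij|ji] := leqP i j; first by rewrite de// mulr0);
  have [p dp] : pathc j s = 0 /\ dpathc j s = 0.
- apply: pathc_gt; rewrite (le_trans _ Ms)// natr1 ler_nat ltnS.
  exact: leq_trans (ltnW ji) iM.
- by rewrite p mul0r.
- apply: pathc_gt; rewrite (le_trans _ Ms)// natr1 ler_nat ltnS.
  exact: leq_trans (ltnW ji) iM.
- by rewrite dp mul0r.
Qed.

Lemma is_diff_path_height J (u : X -> R) x : differentiable u x ->
  is_diff x (fun y => dot y (path J (u y)))
    (fun v => dot v (path J (u x)) + dot x (dpath J (u x)) * 'd u x v).
Proof.
move=> du; have bd := dot_bounded_bilinear hdot.
have is_diff_bd := is_diff_bounded_bilinear bd.
have bsc := @scale_bounded_bilinear R X.
have dpathE : is_diff x (fun y => path J (u y))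
  (fun v => 'd u x v *: dpath J (u x)).
  rewrite /path /dpath; elim: J => [|J IH].
    have := is_diff_cst (0 : X) x; congr is_diff_def.
      by apply/funext => y; rewrite big_ord0.
    by apply/funext => v; rewrite big_ord0 scaler0.
  have hc : is_diff x (fun y => pathc J (u y))
    (fun v => 'd u x v * dpathc J (u x)).
    have [dc cE] := is_derive_pathc J (u x).
    have dc' : differentiable (pathc J) (u x) by apply/derivable1_diffP.
    apply: DiffDef; first exact: (differentiable_comp du dc').
    rewrite [LHS](diff_comp du dc'); apply/funext => v /=.
    by rewrite diff1E// derive1E cE.
  have he := is_diff_bounded_bilinear bsc hc (is_diff_cst (e J) x).
  have := is_diffD IH he; congr is_diff_def.
    by apply/funext => y; rewrite /= big_ord_recr.
  apply/funext => v; rewrite big_ord_recr/= scalerDr scalerA.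
  rewrite -[LHS]/('d u x v *: (\sum_(i < J) dpathc i (u x) *: e i) +
    (('d u x v * dpathc J (u x)) *: e J + pathc J (u x) *: 0)).
  by rewrite scaler0 addr0.
have := is_diff_bd _ _ _ _ _ _ (is_diff_id x) dpathE; congr is_diff_def.
by apply/funext => v /=; rewrite dotZr mulrC.
Qed.

Lemma Ck_path_height k J (U : set X) (u : X -> R) : open U -> Ck k U u ->
  Ck k U (fun y => dot y (path J (u y))).
Proof.
move=> oU Cu; apply: Ck_bilinear => //; first exact: dot_bounded_bilinear.
  have idc : (id : X -> X) \in @clin R X X.
    by apply: bounded_linear_clin => //; exists 1 => v; rewrite mul1r.
  exact: (Ck_linear k (CLinear idc) oU).
rewrite /path; elim: J => [|J IH].
  by apply: (Ck_eq (g := cst 0) oU); [move=> x _;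
    rewrite big_ord0|exact: Ck_cst].
apply: (Ck_eq (g := fun y => path J (u y) + pathc J (u y) *: e J) oU).
  by move=> x _; rewrite big_ord_recr.
apply: Ck_add => //; apply: Ck_scale => //; last exact: Ck_cst.
exact: smooth_op_pathc.
Qed.

End Rotation.

Lemma separable_sequence (R : realType) (X : normedModType R) : separable X ->
  exists d : nat -> X, forall x (e : R), 0 < e -> exists i, `|x - d i| < e.
Proof.
move=> [A cA dA].
have A0 : A !=set0.
  have := dA setT; rewrite setTI; apply; [by exists 0|exact: openT].
have /pfcard_geP[A00|[g]] := cA.
  by move: A0; rewrite A00 => -[].
exists g => x e e0.
have [|y [By Ay]] := dA (ball x e) _ (ball_open x e).
  by exists x; exact: ballxx.
have [n _ gn] : (g @` setT) y by exact: (@surj _ _ _ _ g y).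
by exists n; rewrite gn; move: By; rewrite -ball_normE.
Qed.

Section Perturbation.
Context {R : realType} {X : normedModType R} (dot : {dot X for @idfun R}).
Hypothesis hdot : norm_of_inner_product dot.
Variables (d e : nat -> X) (U : set X).
Hypothesis oU : open U.
Hypothesis d_dense : forall x (r : R), 0 < r -> exists i, `|x - d i| < r.
Hypothesis e_orthonormal : forall i j, dot (e i) (e j) = (i == j)%:R.
Hypothesis d_orth_e : forall i j, (i <= j)%N -> dot (d i) (e j) = 0.
Local Notation orth_upto := (orth_upto dot d).
Local Notation locally_radial := (locally_radial dot d).

(** What the gradients of [F] and [delta] have to satisfy at [x] for the final
argument to apply as soon as [m.+1 <= u x]. *)
Definition tame (F delta : X -> R) (x : X) (m : nat) : Prop :=
  exists lam al : R,
    (forall v, orth_upto m v ->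
       'd F x v = lam * dot x v /\ 'd delta x v = al * dot x v) /\
    (forall p, dot p p = 1 -> orth_upto m p ->
       `|dot x p| <= 1 /\
       `|dot x p| * (`|lam| + `|al| * `|dot x p|) < delta x).

Lemma tame_le F delta x m m' : (m <= m')%N ->
  tame F delta x m -> tame F delta x m'.
Proof.
move=> mm [lam [al [h1 h2]]]; exists lam, al; split=> [v ov|p p1 op].
  by apply: h1; exact: orth_upto_le ov.
by apply: h2 => //; exact: orth_upto_le op.
Qed.

(** If [p] is a unit vector orthogonal to [d i], then [`|dot y p| = `|dot (y -
d i) p| <= `|y - d i|], and by density the latter can be made small near [x].
*)
Lemma locally_tame F delta : locally_radial U F -> locally_radial U delta ->
  (forall x, U x -> 0 < delta x) ->
  forall x, U x -> exists (r : R) m, 0 < r /\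
    forall y, ball x r y -> tame F delta y m.
Proof.
move=> rF rdelta delta0 x Ux.
have [N1 [W1 [oW1 W1x r1]]] := rF x Ux.
have [N2 [W2 [oW2 W2x r2]]] := rdelta x Ux.
have [_ [lam [clam dF]]] := r1; have [_ [al [cal ddelta]]] := r2.
have dx0 := delta0 x Ux.
pose L := (`|lam x| + 1) + (`|al x| + 1).
have L0 : 0 < L by rewrite addr_gt0// ltr_wpDl.
(* The constant is such that k * L < delta x / 2 < delta y for y near x. *)
pose k := Num.min 1 (delta x / 4 / L).
have k0 : 0 < k by rewrite lt_min ltr01 !divr_gt0.
have k1 : k <= 1 by rewrite ge_min lexx.
have kL : k * L <= delta x / 4 by rewrite -ler_pdivlMr// ge_min lexx orbT.
have [i xi] := d_dense x (divr_gt0 k0 (ltr0n R 2)).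
pose m := maxn (maxn N1 N2) i.
have near_tame : \forall y \near x, tame F delta y m.
  have cd := radial_continuous r2 W2x.
  near=> y.
  have W1y : W1 y by near: y; exact: open_nbhs_nbhs.
  have W2y : W2 y by near: y; exact: open_nbhs_nbhs.
  have ly : `|lam y| < `|lam x| + 1.
    near: y; apply: (cvgr_norm_lt (lam x)); first exact: clam.
    by rewrite ltrDl.
  have ay : `|al y| < `|al x| + 1.
    near: y; apply: (cvgr_norm_lt (al x)); first exact: cal.
    by rewrite ltrDl.
  have dy : delta x / 2 < delta y.
    near: y; apply: (cvgr_gt (delta x)); first exact: cd.
    by rewrite ltr_pdivrMr// ltr_pMr// ltr1n.
  have yx : `|x - y| < k / 2.
    near: y; have := nbhsx_ballx x _ (divr_gt0 k0 (ltr0n R 2)).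
    by apply: filterS => z; rewrite -ball_normE.
  exists (lam y), (al y); split=> [v ov|p p1 op].
    split; [apply: dF|apply: ddelta] => //; apply: orth_upto_le ov.
      by rewrite /m !leq_max leqnn.
    by rewrite /m !leq_max leqnn orbT.
  have pk : `|dot y p| <= k.
    have -> : dot y p = dot (y - d i) p.
      by rewrite dotBl op ?subr0// /m leq_maxr.
    rewrite (le_trans (dot_CS hdot _ _))//.
    have -> : `|p| = 1.
      by apply/eqP; rewrite -(@eqrXn2 _ 2) ?ler01// expr1n -(dotvv hdot) p1.
    rewrite mulr1 (_ : y - d i = (x - d i) - (x - y));
      last by rewrite opprB [RHS]addrC addrA subrK.
    rewrite (le_trans (ler_normB _ _))// [leRHS]splitr.
    by rewrite lerD// ltW.
  split; first exact: le_trans k1.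
  apply: (@le_lt_trans _ _ (k * L)); last first.
    by apply: (le_lt_trans kL); apply: lt_trans dy;
      rewrite ltr_pM2l// ltf_pV2 ?posrE// ltr_nat.
  apply: ler_pM => //.
  apply: lerD; first exact: ltW.
  by rewrite (le_trans _ (ltW ay))// ler_piMr// (le_trans pk).
have /nbhs_ballP[r r0 h] := near_tame.
by exists r, m; split => // y; exact: h.
Unshelve. all: by end_near. Qed.

(** The truncation of the path in [psi] depends on the point, but [psi] agrees
near each point with some [psiJ j], since [u] is locally bounded. *)
Lemma perturbation_noncritical F delta : locally_radial U F ->
  locally_radial U delta ->
  (forall x, U x -> 0 < delta x) ->
  exists psi : X -> R, Cinfty U psi /\ forall x, U x ->
    `|F x - psi x| <= delta x /\ 'd psi x <> cst 0 :> (X -> R).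
Proof.
move=> rF rdelta delta0.
have [u [ru hu]] := radial_exhaustion hdot d_dense
  (fun x m m' => @tame_le F delta x m m') (locally_tame rF rdelta delta0).
pose J x := (Num.truncn (u x)).+2.
pose psi x := F x + delta x * dot x (path e (J x) (u x)).
pose psiJ j x := F x + delta x * dot x (path e j (u x)).
have CF := locally_radial_Cinfty oU rF.
have Cd := locally_radial_Cinfty oU rdelta.
have Cu := locally_radial_Cinfty oU ru.
have uJ x : u x <= (J x)%:R - 1 by rewrite /J -natr1 addrK ltW// truncnS_gt.
have psiE x : U x -> \forall y \near x, psi y = psiJ (J x).+1 y.
  move=> Ux; have cu : {for x, continuous u}.
    by apply: differentiable_continuous; exact: Cinfty_differentiable Cu Ux.
  near=> y.
  have uy : u y < u x + 1 by near: y; apply: (cvgr_lt (u x)); rewrite ?ltrDl.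
  rewrite /psi /psiJ; congr (_ + _ * dot _ _).
  have h1 : u y <= (J x).+1%:R - 1
    by rewrite -natr1 addrK (le_trans (ltW uy))// -lerBrDr.
  rewrite -(path_stable e (uJ y) (leq_maxl _ (J x).+1)).
  by rewrite -[RHS](path_stable e h1 (leq_maxr (J y) _)).
have CpsiJ j k : Ck k U (psiJ j).
  by apply: Ck_add => //; apply: Ck_scale => //; exact: Ck_path_height.
exists psi; split=> [k|x Ux].
  apply: Ck_local => // x Ux.
  pose W := [set y : X | \forall z \near y, psi z = psiJ (J x).+1 z].
  exists (U `&` W), (psiJ (J x).+1); split.
  - by apply: openI => //; exact: open_interior.
  - by split => //; exact: psiE.
  - by move=> y [_ /nbhs_singleton].
  - apply: (Ck_sub _ oU _ (CpsiJ _ k)); last by move=> y [].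
    by apply: openI => //; exact: open_interior.
have [M [be [Mu [lam [al [dFd small]]] dbe]]] := hu x Ux.
set s := u x in Mu; set j := (J x).+1.
have s0 : 0 <= s by rewrite (le_trans _ Mu).
have sj : s <= j%:R - 1.
  by rewrite (le_trans (uJ x))// lerD2r ler_nat.
have [op oq] := path_orth j d_orth_e Mu.
set p := path e j s in op; set q := dpath e j s in oq.
have p1 : dot p p = 1 by exact: path_unit.
have qp : dot q p = 0 by exact: path_dpath.
have [xp1 xp] := small p p1 op.
have psix : psi x = psiJ j x by exact: nbhs_singleton (psiE x Ux).
split.
  rewrite psix /psiJ -/s -/p opprD addrA subrr sub0r normrN normrM.
  by rewrite (gtr0_norm (delta0 x Ux)) ler_piMr// ltW// delta0.
move=> d0.
have dpsi v : orth_upto M v -> 'd psi x v =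
    (lam + delta x * (dot x q * be) + dot x p * al) * dot x v + delta x * dot v
      p.
  move=> ov.
  have dF := Cinfty_differentiable CF Ux;
    have dd := Cinfty_differentiable Cd Ux.
  have du := Cinfty_differentiable Cu Ux.
  have hL := is_diff_path_height hdot e j du.
  have hp := is_diffD (differentiableP dF) (is_diffM (differentiableP dd) hL).
  have [dpsiJ EJ] := hp.
  have [_ ->] : is_diff x psi ('d (psiJ j) x)
    by exact: is_diff_germ (psiE x Ux) dpsiJ.
  rewrite [LHS](congr1 (fun g => g v) EJ).
  have [dFv ddv] := dFd v ov.
  rewrite -[LHS]/('d F x v + (delta x * (dot v p + dot x q * 'd u x v) + dot x
    p * 'd delta x v)).
  by rewrite dFv ddv dbe//; ring.
have := dpsi p op; have := dpsi q oq; rewrite d0 /= p1 qp mulr0 addr0 mulr1.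
set C := _ + _ => /esym/eqP;
  rewrite mulf_eq0 => /orP[/eqP -> /esym/eqP|/eqP xq].
  by rewrite mul0r add0r gt_eqF// delta0.
(* Here the uncontrolled coefficient be of the gradient of u disappears. *)
have -> : C = lam + dot x p * al by rewrite /C xq mul0r mulr0 addr0.
move=> /esym/eqP; rewrite addr_eq0 => /eqP h.
move: xp; rewrite ltNge => /negP; apply.
have -> : delta x = `|dot x p| * `|lam + dot x p * al|.
  by rewrite -normrM mulrC h normrN gtr0_norm// delta0.
rewrite ler_wpM2l// (le_trans (ler_normD _ _))// lerD2l.
by rewrite normrM mulrC.
Unshelve. all: by end_near. Qed.

End Perturbation.

Theorem theorem1p1 (R : realType) (X : completeNormedModType R)
    (dot : {dot X for @idfun R}) (hdot : norm_of_inner_product dot)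
    (hsep : separable X) (hdim : ~ finite_dimensional X)
    (U : set X) (hU : open U) (f eps : X -> R)
    (hf : {within U, continuous f}) (heps : {within U, continuous eps})
    (heps0 : forall x, U x -> 0 < eps x) :
  exists psi : X -> R, Cinfty U psi /\
    forall x, U x ->
      `|f x - psi x| <= eps x /\ 'd psi x <> cst 0 :> (X -> R).
Proof.
have [d d_dense] := separable_sequence hsep.
have [e [e_on de]] := orthonormal_sequence hdot d hdim.
move: hf heps => /Ck0P-/(_ hU) cf /Ck0P-/(_ hU) ceps.
have [|x Ux|F [rF FP]] :=
  radial_selection (T := fun x c => `|f x - c| <= eps x / 2) (U :=
    U) hdot d_dense.
- move=> x t a b /andP[t0 t1] fa fb.
  rewrite (_ : f x - _ = t * (f x - a) + (1 - t) * (f x - b)); last by ring.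
  have t1' : 0 <= 1 - t by rewrite subr_ge0.
  rewrite (le_trans (ler_normD _ _))// !normrM (ger0_norm t0) (ger0_norm t1').
  rewrite (_ : eps x / 2 = t * (eps x / 2) + (1 - t) * (eps x / 2));
    last by ring.
  by apply: lerD; apply: ler_wpM2l.
- have e0 := heps0 x Ux.
  have /nbhs_ballP[r r0 h] : \forall y \near x, `|f y - f x| <= eps y / 2.
    near=> y.
    have h1 : eps x / 2 < eps y.
      near: y; apply: (cvgr_gt (eps x)); first exact: ceps.
      by rewrite ltr_pdivrMr// ltr_pMr// ltr1n.
    have h2 : `|f x - f y| < eps x / 4.
      by near: y; apply: cvgr_dist_lt; [exact: cf|rewrite divr_gt0].
    by rewrite distrC ltW//; lra.
  by exists r, (f x); split.
have [|x Ux|delta [rdelta deltaP]] :=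
  radial_selection (T := fun x c => 0 < c <= eps x / 2) (U := U) hdot d_dense.
- move=> x t a b /andP[t0 t1] /andP[a0 ae] /andP[b0 be].
  rewrite (_ : eps x / 2 = t * (eps x / 2) + (1 - t) * (eps x / 2));
    last by ring.
  rewrite lerD ?ler_wpM2l ?subr_ge0// andbT.
  have [->|tn0] := eqVneq t 0; first by rewrite mul0r add0r subr0 mul1r.
  rewrite ltr_pwDl ?mulr_ge0 ?subr_ge0// ?(ltW b0)// mulr_gt0// lt_def tn0.
  exact: t0.
- have e0 := heps0 x Ux.
  have /nbhs_ballP[r r0 h] : \forall y \near x, 0 < eps x / 4 <= eps y / 2.
    near=> y.
    have h1 : eps x / 2 < eps y.
      near: y; apply: (cvgr_gt (eps x)); first exact: ceps.
      by rewrite ltr_pdivrMr// ltr_pMr// ltr1n.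
    by apply/andP; split; lra.
  by exists r, (eps x / 4); split.
have delta0 x : U x -> 0 < delta x by case/deltaP/andP.
have [psi [Cpsi psiP]] :=
  perturbation_noncritical hdot hU d_dense e_on de rF rdelta delta0.
exists psi; split=> // x Ux; have [Fpsi dpsi] := psiP x Ux; split => //.
rewrite (_ : f x - psi x = (f x - F x) + (F x - psi x));
  last by rewrite addrA subrK.
rewrite (le_trans (ler_normD _ _))// [leRHS]splitr lerD ?FP//.
by rewrite (le_trans Fpsi)//; case/andP: (deltaP x Ux).
Unshelve. all: by end_near. Qed.
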